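(* Let $(K_{i,j})_{i,j\ge1}$ and $(J_{i,j})_{i,j\ge 1}$ be real numbers with $0\le K_{i,j}=K_{j,i}$ and $0\le J_{i,j}=J_{j,i}$ for all $i,j\ge1$. Assume there exist non-negative real sequences $(\rho_i)_{i\ge1}$ and $(\beta_{i,j})_{i,j\ge1}$ such that $K_{i,j}=\rho_i\rho_j+\beta_{i,j}$ for all $i,j\ge1$, that $\inf_{i\ge1}\frac{\rho_i}{i}=S>0$, that for some $\kappa>0$ one has $\beta_{i,j}\le\kappa\rho_i\rho_j$ for all $i,j\ge1$, and that $J_{i,j}\le\rho_i\rho_j$ for all $i,j\ge1$. If $a^0=(a_i^0)_{i\ge1}\in X_0^+$ and $b^0=(b_i^0)_{i\ge1}\in X_0^+$, then there exists at least one solution $(a,b)$ on $[0,\infty)$ of the coagulation--annihilation system with rates $K$, $J$ and initial data $(a^0,b^0)$. In addition, this solution satisfies, for each $t\in(0,\infty)$, $$(a(t),b(t))\in X_0^+\times X_0^+,\qquad \|a(t)\|_1<\infty,\qquad \|b(t)\|_1<\infty .$$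
   Context: For $p\in\mathbb{R}$, $X_p$ is the space of real sequences $x=(x_i)_{i\ge1}$ with $\|x\|_p=\sum_{i=1}^\infty i^p|x_i|<\infty$, and $X_p^+=\{x\in X_p: x_i\ge0\text{ for all }i\ge1\}$. The coagulation--annihilation system is, for $i\in\mathbb{N}=\{1,2,\dots\}$ and $t>0$, $$\frac{da_i}{dt}=\frac12\sum_{j=1}^{i-1}K_{j,i-j}a_ja_{i-j}-\sum_{j=1}^\infty K_{i,j}a_ia_j-\sum_{j=1}^\infty J_{i,j}a_ib_j,\qquad \frac{db_i}{dt}=\frac12\sum_{j=1}^{i-1}K_{j,i-j}b_jb_{i-j}-\sum_{j=1}^\infty K_{i,j}b_ib_j-\sum_{j=1}^\infty J_{i,j}b_ia_j,$$ with $a_i(0)=a_i^0\ge0$, $b_i(0)=b_i^0\ge0$ (for $i=1$ the first sums are zero). Solution: for $T\in(0,\infty]$, a pair $(a,b)=((a_i)_{i\ge1},(b_i)_{i\ge1})$ of sequences of non-negative functions is a solution on $[0,T)$ with initial data $(a^0,b^0)$ if (1) $a_i,b_i\in C([0,T))$ for each $i\in\mathbb{N}$; (2) for each $i\in\mathbb{N}$ and $t\in[0,T)$, the functions $\sum_{j=1}^\infty K_{i,j}a_j$, $\sum_{j=1}^\infty K_{i,j}b_j$, $\sum_{j=1}^\infty J_{i,j}a_j$, $\sum_{j=1}^\infty J_{i,j}b_j$ belong to $L^1(0,t)$; (3) for each $i\in\mathbb{N}$ and $t\in(0,T)$, $$a_i(t)=a_i^0+\int_0^t\Big(\tfrac12\sum_{j=1}^{i-1}K_{j,i-j}a_j(s)a_{i-j}(s)-a_i(s)\sum_{j=1}^\infty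 K_{i,j}a_j(s)-a_i(s)\sum_{j=1}^\infty J_{i,j}b_j(s)\Big)ds,$$ $$b_i(t)=b_i^0+\int_0^t\Big(\tfrac12\sum_{j=1}^{i-1}K_{j,i-j}b_j(s)b_{i-j}(s)-b_i(s)\sum_{j=1}^\infty K_{i,j}b_j(s)-b_i(s)\sum_{j=1}^\infty J_{i,j}a_j(s)\Big)ds.$$ *)

(* Defs.v *)
From HB Require Import structures.
From mathcomp Require Import all_boot all_order all_algebra.
From mathcomp Require Import all_classical all_reals all_analysis.
Set Implicit Arguments.
Unset Strict Implicit.
Unset Printing Implicit Defensive.
Import Order.TTheory GRing.Theory Num.Theory.
Import numFieldNormedType.Exports.
Local Open Scope classical_set_scope.
Local Open Scope ring_scope.

(* Families indexed by i >= 1 are functions on nat whose values at index 0 are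
   never used: sums start at 1 and quantifiers carry the guard (1 <= i)%N. *)

(* \sum_(i >= 1) i^p |x_i|, as an extended real: it is +oo when the series
   diverges. *)
Definition Xnorm (R : realType) (p : R) (x : nat -> R) : \bar R :=
  (\sum_(1 <= i <oo) (i%:R `^ p * `|x i|)%:E)%E.

Definition Xspace (R : realType) (p : R) : set (nat -> R) :=
  [set x | (Xnorm p x < +oo)%E].

Definition Xpos (R : realType) (p : R) : set (nat -> R) :=
  [set x | Xspace p x /\ forall i, (1 <= i)%N -> 0 <= x i].

(* \sum_(j >= 1) M_(i,j) u_j(s). *)
Definition rate_sum (R : realType) (M : nat -> nat -> R) (u : nat -> R -> R)
    (i : nat) (s : R) : \bar R :=
  (\sum_(1 <= j <oo) (M i j * u j s)%:E)%E.

(* Right-hand side of the equation for u_i, where v is the other species.  It is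
   extended-real valued because membership of the rate sums in L^1 only makes
   them finite almost everywhere. *)
Definition ca_rhs (R : realType) (K J : nat -> nat -> R) (u v : nat -> R -> R)
    (i : nat) (s : R) : \bar R :=
  ((2^-1 * \sum_(1 <= j < i) K j (i - j)%N * u j s * u (i - j)%N s)%:E
   - (u i s)%:E * rate_sum K u i s
   - (u i s)%:E * rate_sum J v i s)%E.

Definition time_domain (R : realType) (T : \bar R) : set R :=
  [set t | 0 <= t /\ (t%:E < T)%E].

(* The values of a and b outside [0, T) are irrelevant. *)
Record ca_solution (R : realType) (K J : nat -> nat -> R) (a0 b0 : nat -> R)
    (T : \bar R) (a b : nat -> R -> R) : Prop := CaSolution {
  ca_horizon : (0 < T)%E ;
  ca_ge0 : forall (i : nat) (t : R), (1 <= i)%N -> time_domain T t ->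
    0 <= a i t /\ 0 <= b i t ;
  ca_continuous : forall i, (1 <= i)%N ->
    {within time_domain T, continuous (a i)} /\
    {within time_domain T, continuous (b i)} ;
  ca_integrable : forall (i : nat) (t : R), (1 <= i)%N -> time_domain T t ->
    [/\ lebesgue_measure.-integrable `]0, t[ (rate_sum K a i),
        lebesgue_measure.-integrable `]0, t[ (rate_sum K b i),
        lebesgue_measure.-integrable `]0, t[ (rate_sum J a i) &
        lebesgue_measure.-integrable `]0, t[ (rate_sum J b i)] ;
  ca_equation : forall (i : nat) (t : R), (1 <= i)%N -> 0 < t -> (t%:E < T)%E ->
    (a i t)%:E = ((a0 i)%:E
      + \int[lebesgue_measure]_(s in `]0%R, t[) ca_rhs K J a b i s)%E /\
    (b i t)%:E = ((b0 i)%:E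
      + \int[lebesgue_measure]_(s in `]0%R, t[) ca_rhs K J b a i s)%E
}.

(* Main.v *)
Require Import Defs.
From HB Require Import structures.
From mathcomp Require Import all_boot all_order all_algebra.
From mathcomp Require Import all_classical all_reals all_analysis.
From mathcomp Require Import ring lra zify.
Set Implicit Arguments.
Unset Strict Implicit.
Unset Printing Implicit Defensive.
Import Order.TTheory GRing.Theory Num.Theory.
Import numFieldNormedType.Exports.
Local Open Scope classical_set_scope.
Local Open Scope ring_scope.

(* Truncate the system to clusters of size < n and discretize it by an explicit
   Euler scheme whose step is so small that positivity is preserved.  For a
   weight g >= 0, each step changes sum_i g_i x_i by at most
     - h/2 * sum_(i,j) (g_i + g_j - g_(i+j)) K_(i,j) x_i x_j,
   and K_(i,j) >= rho_i rho_j.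
   With g_i = min(i,m)/m this bounds h * sum_steps (sum_(i >= m) rho_i x_i)^2 by
   2 sum_i g_i x_i(0), uniformly in n, and the latter tends to 0 as m grows.
   Hence the rate sums have uniformly small tails in L^1(0,t), and each component
   has a modulus of continuity uniform in n.  With g_i = i the first moment is
   nonincreasing, and since rho_i >= S i the case m = 1 gives
   t * (S ||x(t)||_1)^2 <= 2 ||x(0)||_0.
   A limit along an ultrafilter on n is locally uniform in t, and the small tails
   allow passing to the limit in the integral equation. *)

(** * Rearrangements of finite sums *)

Lemma ler_sum_subnat (R : numDomainType) (f : nat -> R) (m p n : nat) :
  (forall j, (m <= j < n)%N -> 0 <= f j) -> (p <= n)%N ->
  \sum_(m <= j < p) f j <= \sum_(m <= j < n) f j.
Proof.
move=> f0 pn; have [mp|pm] := leqP m p; last first.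
  rewrite big_geq; last exact: ltnW.
  by rewrite big_nat sumr_ge0.
rewrite (@big_cat_nat _ _ _ p _ n) //= lerDl big_nat sumr_ge0 // => j /andP[pj jn].
by apply: f0; rewrite jn (leq_trans mp pj).
Qed.

(** Raising [n] by one adds the outer index [i = n] on the left, and the term [k = n - j] to each
    inner sum on the right. Both are the antidiagonal [j + k = n]. *)
Lemma sum_antidiagonals (V : nmodType) (f : nat -> nat -> V) (n : nat) :
  \sum_(1 <= i < n) \sum_(1 <= j < i) f j (i - j)%N =
  \sum_(1 <= j < n) \sum_(1 <= k < n - j) f j k.
Proof.
elim: n => [|[|n] IH]; [by rewrite !big_geq | by rewrite !big_geq |].
rewrite big_nat_recr //= IH [RHS]big_nat_recr //= subSnn [X in _ = _ + X]big_geq //.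
rewrite addr0 -big_split /= big_nat [RHS]big_nat; apply: eq_bigr => j /andP[j0 jn].
by rewrite [in RHS]subSn 1?ltnW // [RHS]big_nat_recr // subn_gt0.
Qed.

(** * Estimates for the truncated Euler scheme *)

Section EulerScheme.
Context (R : realFieldType) (K J : nat -> nat -> R).
Hypothesis K_ge0 : forall i j, (1 <= i)%N -> (1 <= j)%N -> 0 <= K i j.
Hypothesis K_sym : forall i j, (1 <= i)%N -> (1 <= j)%N -> K i j = K j i.
Hypothesis J_ge0 : forall i j, (1 <= i)%N -> (1 <= j)%N -> 0 <= J i j.

Definition gain (x : nat -> R) i : R :=
  2^-1 * \sum_(1 <= j < i) K j (i - j)%N * x j * x (i - j)%N.

Definition trunc_rate (M : nat -> nat -> R) n (x : nat -> R) i : R :=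
  \sum_(1 <= j < n) M i j * x j.

Definition drift n (x y : nat -> R) i : R :=
  gain x i - x i * trunc_rate K n x i - x i * trunc_rate J n y i.

(* The two species are indexed by [bool], so that [~~ c] is the species that
   annihilates [c]. *)
Definition euler_step n h (u : bool -> nat -> R) (c : bool) (i : nat) : R :=
  if (0 < i < n)%N then u c i + h * drift n (u c) (u (~~ c)) i else 0.

(** The data are cut to 0 at the meaningless index 0 as well as from [n] on, so that nonnegativity
    of the iterates can be stated at every index without a guard. *)
Definition euler n h (u : bool -> nat -> R) k : bool -> nat -> R :=
  iter k (euler_step n h) (fun c i => if (0 < i < n)%N then u c i else 0).

Arguments euler : simpl never.

Lemma gain_ge0 x i : (forall j, 0 <= x j) -> 0 <= gain x i.
Proof.
move=> x0; rewrite mulr_ge0 ?invr_ge0 // big_nat sumr_ge0 // => j /andP[j1 ji].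
by rewrite !mulr_ge0 // K_ge0 // subn_gt0.
Qed.

Lemma trunc_rate_ge0 (M : nat -> nat -> R) n x i :
  (forall i j, (1 <= i)%N -> (1 <= j)%N -> 0 <= M i j) ->
  (forall j, 0 <= x j) -> (1 <= i)%N -> 0 <= trunc_rate M n x i.
Proof.
move=> M0 x0 i1; rewrite /trunc_rate big_nat sumr_ge0 // => j /andP[j1 _].
by rewrite mulr_ge0 // M0.
Qed.

(** After reindexing by the two merging sizes, the right-hand side also counts pairs with
    [i + j >= n], whose product leaves the truncated system. This is why only an inequality
    holds. *)
Lemma sum_weight_gain (g x : nat -> R) n :
  (forall i, 0 <= g i) -> (forall i, 0 <= x i) ->
  \sum_(1 <= i < n) g i * gain x i <=
  2^-1 * \sum_(1 <= i < n) \sum_(1 <= j < n) g (i + j)%N * (K i j * x i * x j).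
Proof.
move=> g0 x0.
pose f i j := g (i + j)%N * (K i j * x i * x j).
have -> : \sum_(1 <= i < n) g i * gain x i =
    2^-1 * \sum_(1 <= i < n) \sum_(1 <= j < i) f j (i - j)%N.
  rewrite mulr_sumr; apply: eq_bigr => i _; rewrite /gain mulrCA; congr (_ * _).
  rewrite mulr_sumr big_nat [RHS]big_nat; apply: eq_bigr => j /andP[j1 ji].
  by rewrite /f subnKC // ltnW.
rewrite sum_antidiagonals ler_wpM2l ?invr_ge0 //.
apply: ler_sum_nat => i /andP[i1 _]; apply: ler_sum_subnat; last exact: leq_subr.
by move=> j /andP[j1 _]; rewrite /f !mulr_ge0 ?K_ge0.
Qed.

(** Weak form of the equation with test sequence [g]. Symmetry of [K] shares the coagulation loss
    equally between [g i] and [g j]; annihilation only lowers the sum and is dropped. *)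
Lemma sum_weight_drift (g x y : nat -> R) n :
  (forall i, 0 <= g i) -> (forall i, 0 <= x i) -> (forall i, 0 <= y i) ->
  \sum_(1 <= i < n) g i * drift n x y i <=
  - (2^-1 * \sum_(1 <= i < n) \sum_(1 <= j < n)
       (g i + g j - g (i + j)%N) * (K i j * x i * x j)).
Proof.
move=> g0 x0 y0.
pose D := \sum_(1 <= i < n) \sum_(1 <= j < n) g i * (K i j * x i * x j).
have DE : \sum_(1 <= i < n) g i * (x i * trunc_rate K n x i) = D.
  apply: eq_bigr => i _; rewrite /trunc_rate !mulr_sumr; apply: eq_bigr => j _.
  by ring.
have DsymE : \sum_(1 <= i < n) \sum_(1 <= j < n) g j * (K i j * x i * x j) = D.
  rewrite exchange_big_nat /=; apply: eq_big_nat => i /andP[i1 _].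
  by apply: eq_big_nat => j /andP[j1 _]; rewrite K_sym //; ring.
have J0 : 0 <= \sum_(1 <= i < n) g i * (x i * trunc_rate J n y i).
  rewrite big_nat sumr_ge0 // => i /andP[i1 _].
  by rewrite !mulr_ge0 // trunc_rate_ge0.
have -> : \sum_(1 <= i < n) g i * drift n x y i =
    \sum_(1 <= i < n) g i * gain x i - D
      - \sum_(1 <= i < n) g i * (x i * trunc_rate J n y i).
  rewrite -DE -!sumrB; apply: eq_bigr => i _; rewrite /drift; ring.
have -> : \sum_(1 <= i < n) \sum_(1 <= j < n)
       (g i + g j - g (i + j)%N) * (K i j * x i * x j) =
    D + D - \sum_(1 <= i < n) \sum_(1 <= j < n) g (i + j)%N * (K i j * x i * x j).
  rewrite -{2}DsymE /D -big_split -sumrB; apply: eq_bigr => i _ /=.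
  by rewrite -big_split -sumrB; apply: eq_bigr => j _ /=; ring.
have := sum_weight_gain n g0 x0.
lra.
Qed.

Lemma euler0 n h u c i :
  euler n h u 0 c i = if (0 < i < n)%N then u c i else 0.
Proof. by []. Qed.

Lemma euler_out n h u k c i : ~~ (0 < i < n)%N -> euler n h u k c i = 0.
Proof. by case: k => [|k] /negbTE; rewrite /euler /= /euler_step => ->. Qed.

Lemma eulerS n h u k c i : (0 < i < n)%N ->
  euler n h u k.+1 c i = euler n h u k c i
    + h * drift n (euler n h u k c) (euler n h u k (~~ c)) i.
Proof. by rewrite /euler /= /euler_step => ->. Qed.

Lemma euler_sum n h u k c i : (0 < i < n)%N ->
  euler n h u k c i = u c i
    + h * \sum_(0 <= l < k) drift n (euler n h u l c) (euler n h u l (~~ c)) i.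
Proof.
move=> iN; elim: k => [|k IH]; first by rewrite big_geq // mulr0 addr0 euler0 iN.
by rewrite big_nat_recr //= mulrDr addrA -IH eulerS.
Qed.

Lemma eulerS_weight (g : nat -> R) n h u k c :
  0 <= h -> (forall i, 0 <= g i) -> (forall c i, 0 <= euler n h u k c i) ->
  \sum_(1 <= i < n) g i * euler n h u k.+1 c i <=
  \sum_(1 <= i < n) g i * euler n h u k c i
  - h * (2^-1 * \sum_(1 <= i < n) \sum_(1 <= j < n)
       (g i + g j - g (i + j)%N) * (K i j * euler n h u k c i * euler n h u k c j)).
Proof.
move=> h0 g0 x0.
have -> : \sum_(1 <= i < n) g i * euler n h u k.+1 c i =
    \sum_(1 <= i < n) g i * euler n h u k c i
    + h * \sum_(1 <= i < n)
            g i * drift n (euler n h u k c) (euler n h u k (~~ c)) i.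
  rewrite mulr_sumr -big_split; apply: eq_big_nat => i iN /=.
  by rewrite eulerS //; ring.
rewrite lerD2l -mulrN ler_wpM2l //.
by apply: sum_weight_drift.
Qed.

(** * A priori bounds uniform in the truncation *)

Section Bounds.
Variables (n : nat) (h M : R) (u : bool -> nat -> R).
Hypothesis h_ge0 : 0 <= h.
Hypothesis u_ge0 : forall c i, (1 <= i)%N -> 0 <= u c i.
Hypothesis u_le : forall c, \sum_(1 <= i < n) u c i <= M.
Hypothesis h_le :
  h * (\sum_(1 <= i < n) \sum_(1 <= j < n) (K i j + J i j) * M) <= 1.

Let X := euler n h u.

Lemma le_sum_nat1 (x : nat -> R) i : (forall i, 0 <= x i) -> (0 < i < n)%N ->
  x i <= \sum_(1 <= j < n) x j.
Proof.
move=> x0 iN; rewrite (@big_cat_nat _ _ _ i) /=; [|lia|lia].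
rewrite [X in _ + X]big_ltn; last lia.
have : 0 <= \sum_(1 <= j < i) x j by exact: sumr_ge0.
have : 0 <= \sum_(i.+1 <= j < n) x j by exact: sumr_ge0.
lra.
Qed.

(** The two invariants need each other: the mass bound limits the loss rate, so that a step keeps
    the densities nonnegative, and nonnegativity makes the mass nonincreasing. *)
Lemma euler_ge0_le k :
  (forall c i, 0 <= X k c i) /\ (forall c, \sum_(1 <= i < n) X k c i <= M).
Proof.
elim: k => [|k [X0 XM]].
  split=> c; first by move=> i; rewrite /X euler0; case: ifP => // /andP[i1 _]; exact: u_ge0.
  apply: le_trans (u_le c).
  by apply: ler_sum_nat => i iN; rewrite /X euler0 iN.
have XleM c i : X k c i <= M.
  have [iN|iN] := boolP (0 < i < n)%N; first exact: le_trans (le_sum_nat1 (X0 c) iN) (XM c).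
  rewrite /X euler_out //; apply: le_trans (XM c); exact: sumr_ge0.
have M0 : 0 <= M by apply: le_trans (XleM true 0%N); exact: X0.
split=> c; last first.
  (* With the weight 1 the defect [g i + g j - g (i + j)] equals 1, so the dissipation term is
     nonnegative. *)
  have := @eulerS_weight (fun=> 1) n h u k c h_ge0 (fun=> ler01) X0.
  have w1 l : \sum_(1 <= i < n) 1 * X l c i = \sum_(1 <= i < n) X l c i.
    by apply: eq_bigr => i _; rewrite mul1r.
  rewrite -/X !w1.
  move=> H; apply: le_trans H _; apply: le_trans (XM c); rewrite lerBlDr lerDl.
  rewrite !mulr_ge0 ?invr_ge0 // big_nat sumr_ge0 // => i /andP[i1 _].
  rewrite big_nat sumr_ge0 // => j /andP[j1 _].
  by rewrite addrK /= mul1r !mulr_ge0 ?K_ge0 //; exact: X0.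
move=> i; have [iN|iN] := boolP (0 < i < n)%N; last by rewrite /X euler_out.
have i1 : (1 <= i)%N by lia.
have KJ0 a b : (1 <= a)%N -> (1 <= b)%N -> 0 <= (K a b + J a b) * M.
  by move=> a1 b1; rewrite mulr_ge0 // addr_ge0 ?K_ge0 ?J_ge0.
rewrite /X eulerS // -/X /drift.
have G0 := gain_ge0 i (X0 c).
set A := trunc_rate K n _ _; set B := trunc_rate J n _ _.
(* As all densities are at most [M], the loss rate [A + B] is at most row [i] of the double sum in
   [h_le]. *)
have AB : h * (A + B) <= 1.
  apply: le_trans h_le; rewrite ler_wpM2l //.
  apply: (@le_trans _ _ (\sum_(1 <= j < n) (K i j + J i j) * M)).
    rewrite -big_split; apply: ler_sum_nat => j /andP[j1 _] /=.
    by rewrite mulrDl lerD // ler_wpM2l ?K_ge0 ?J_ge0 // XleM.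
  (* The row sums are extended by 0, because [le_sum_nat1] asks for nonnegativity at every index and
     nothing is known of [K] and [J] at index 0. *)
  pose f i := if (0 < i < n)%N then \sum_(1 <= j < n) (K i j + J i j) * M else 0.
  have fE a : (0 < a < n)%N -> f a = \sum_(1 <= j < n) (K a j + J a j) * M.
    by rewrite /f => ->.
  rewrite -fE // -(eq_big_nat _ _ fE); apply: le_sum_nat1 => // a; rewrite /f.
  by case: ifP => // aN; rewrite big_nat sumr_ge0 // => j ?; apply: KJ0; lia.
have -> : X k c i + h * (gain (X k c) i - X k c i * A - X k c i * B) =
  h * gain (X k c) i + X k c i * (1 - h * (A + B)) by ring.
by apply: addr_ge0; apply: mulr_ge0; rewrite ?subr_ge0 //; exact: X0.
Qed.

Lemma euler_ge0 k c i : 0 <= X k c i. Proof. by have [] := euler_ge0_le k. Qed.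

Lemma euler_sum_le k c : \sum_(1 <= i < n) X k c i <= M.
Proof. by have [] := euler_ge0_le k. Qed.

Lemma bound_ge0 : 0 <= M.
Proof.
apply: le_trans (euler_sum_le 0 true); apply: sumr_ge0 => i _; exact: euler_ge0.
Qed.

Lemma euler_le k c i : X k c i <= M.
Proof.
have [iN|iN] := boolP (0 < i < n)%N.
  exact: le_trans (le_sum_nat1 (euler_ge0 k c) iN) (euler_sum_le k c).
by rewrite /X euler_out // bound_ge0.
Qed.

(** Merging cannot raise a subadditive weight, and annihilation cannot raise a nonnegative one. *)
Lemma euler_weight_nincr (g : nat -> R) k l c :
  (forall i, 0 <= g i) -> (forall i j, g (i + j)%N <= g i + g j) -> (k <= l)%N ->
  \sum_(1 <= i < n) g i * X l c i <= \sum_(1 <= i < n) g i * X k c i.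
Proof.
move=> g0 gD /subnK <-; elim: (l - k)%N => // d IH; rewrite addSn.
apply: le_trans (eulerS_weight c h_ge0 g0 (euler_ge0 _)) _.
apply: le_trans IH; rewrite lerBlDr lerDl.
rewrite !mulr_ge0 ?invr_ge0 // big_nat sumr_ge0 // => i /andP[i1 _].
rewrite big_nat sumr_ge0 // => j /andP[j1 _].
by rewrite mulr_ge0 ?subr_ge0 // !mulr_ge0 ?K_ge0 //; exact: euler_ge0.
Qed.

Variable rho : nat -> R.
Hypothesis rho_ge0 : forall i, (1 <= i)%N -> 0 <= rho i.
Hypothesis rho_le : forall i j, (1 <= i)%N -> (1 <= j)%N -> rho i * rho j <= K i j.

Definition rho_tail m (x : nat -> R) : R := \sum_(m <= i < n) rho i * x i.

Lemma rho_tail_ge0 m x : (1 <= m)%N -> (forall i, 0 <= x i) -> 0 <= rho_tail m x.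
Proof.
move=> m1 x0; rewrite /rho_tail big_nat sumr_ge0 // => i /andP[mi _].
by rewrite mulr_ge0 // rho_ge0 //; exact: leq_trans mi.
Qed.

(* When two clusters of size [>= m] merge, the weight [g] loses at least one
   unit, so the initial weight bounds the total rate of these mergers. *)
Lemma euler_dissipation (g : nat -> R) m k c : (1 <= m)%N ->
  (forall i, 0 <= g i) -> (forall i j, g (i + j)%N <= g i + g j) ->
  (forall i j, (m <= i)%N -> (m <= j)%N -> g (i + j)%N + 1 <= g i + g j) ->
  h * (\sum_(0 <= l < k) rho_tail m (X l c) ^+ 2) <=
  2 * \sum_(1 <= i < n) g i * u c i.
Proof.
move=> m1 g0 gD gm.
(* Keeping the current weight on the left makes the induction telescope; it is nonnegative and is
   discarded at the end. *)
suff H : \sum_(1 <= i < n) g i * X k c i +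
    2^-1 * (h * (\sum_(0 <= l < k) rho_tail m (X l c) ^+ 2)) <=
    \sum_(1 <= i < n) g i * u c i.
  have : 0 <= \sum_(1 <= i < n) g i * X k c i.
    by apply: sumr_ge0 => i _; rewrite mulr_ge0 //; exact: euler_ge0.
  lra.
elim: k => [|k IH].
  rewrite [X in h * X]big_geq // !mulr0 addr0.
  by rewrite (@eq_big_nat _ _ _ _ _ _ (fun i => g i * u c i)) // => i iN;
     rewrite /X euler0 iN.
have := eulerS_weight c h_ge0 g0 (euler_ge0 k); rewrite -/X.
set D := \sum_(1 <= i < n) \sum_(1 <= j < n) _.
(* All terms of [D] are nonnegative. Those with [i, j >= m] have a defect of at least 1 and
   [K i j >= rho i * rho j], so they already dominate the square of the tail. *)
have DT : rho_tail m (X k c) ^+ 2 <= D.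
  have nn i j : (1 <= i)%N -> (1 <= j)%N ->
      0 <= (g i + g j - g (i + j)%N) * (K i j * X k c i * X k c j).
    by move=> i1 j1; rewrite mulr_ge0 ?subr_ge0 // !mulr_ge0 ?K_ge0 //; exact: euler_ge0.
  have [nm|mn] := leqP n m.
    rewrite /rho_tail big_geq // expr0n /= /D big_nat sumr_ge0 // => i /andP[i1 _].
    by rewrite big_nat sumr_ge0 // => j /andP[j1 _]; exact: nn.
  rewrite /D (@big_cat_nat _ _ _ m) //=; last exact: ltnW.
  rewrite -[leLHS]add0r; apply: lerD.
    rewrite big_nat sumr_ge0 // => i /andP[i1 _].
    by rewrite big_nat sumr_ge0 // => j /andP[j1 _]; exact: nn.
  rewrite expr2 /rho_tail mulr_suml.
  apply: ler_sum_nat => i /andP[mi _].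
  have i1 : (1 <= i)%N by exact: leq_trans mi.
  rewrite [leRHS](@big_cat_nat _ _ _ m) //=; last exact: ltnW.
  rewrite -[leLHS]add0r; apply: lerD.
    by rewrite big_nat sumr_ge0 // => j /andP[j1 _]; exact: nn.
  rewrite mulr_sumr; apply: ler_sum_nat => j /andP[mj _].
  have j1 : (1 <= j)%N by exact: leq_trans mj.
  have -> : rho i * X k c i * (rho j * X k c j) =
    1 * (rho i * rho j * X k c i * X k c j) by ring.
  have Xi := euler_ge0 k c i; have Xj := euler_ge0 k c j.
  apply: ler_pM => //; last by rewrite !ler_wpM2r ?rho_le.
    by rewrite !mulr_ge0 ?rho_ge0.
  by have := gm i j mi mj; lra.
have hDT := ler_wpM2l h_ge0 DT.
rewrite [X in h * X]big_nat_recr //=; rewrite mulrDr; lra.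
Qed.

(** Converts the bound on squares into an L^1 bound over the steps from [k] to [l]. The free
    parameter [A] trades the length of the time window against the initial weight. *)
Lemma sum_rho_tail_le (g : nat -> R) m k l c A : (1 <= m)%N ->
  (forall i, 0 <= g i) -> (forall i j, g (i + j)%N <= g i + g j) ->
  (forall i j, (m <= i)%N -> (m <= j)%N -> g (i + j)%N + 1 <= g i + g j) ->
  0 < A ->
  h * (\sum_(k <= p < l) rho_tail m (X p c)) <=
  A * ((l - k)%:R * h) + A^-1 * (2 * \sum_(1 <= i < n) g i * u c i).
Proof.
move=> m1 g0 gD gm A0.
have sq0 p : 0 <= rho_tail m (X p c) ^+ 2 by exact: sqr_ge0.
have [lk|kl] := leqP l k.
  rewrite big_geq // mulr0 addr_ge0 // mulr_ge0 ?mulr_ge0 ?invr_ge0 //; try exact: ltW.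
  rewrite big_nat sumr_ge0 // => i /andP[i1 _]; rewrite mulr_ge0 //; exact: u_ge0.
(* Young's inequality: [y <= A + y^2 / A]. *)
apply: (@le_trans _ _
  (h * \sum_(k <= p < l) (A + A^-1 * rho_tail m (X p c) ^+ 2))).
  rewrite ler_wpM2l //; apply: ler_sum => p _; set y := rho_tail m _.
  rewrite -(ler_pM2l A0) mulrDr mulrA divff ?gt_eqF // mul1r.
  by have := sqr_ge0 (y - A); have := sqr_ge0 (y + A); rewrite !expr2; lra.
rewrite big_split /= sumr_const_nat -mulr_sumr mulrDr -[A *+ _]mulr_natr.
have -> : h * (A * (l - k)%:R) = A * ((l - k)%:R * h) by ring.
rewrite lerD2l mulrCA ler_wpM2l ?invr_ge0 ?(ltW A0) //.
apply: le_trans (euler_dissipation l c m1 g0 gD gm); rewrite ler_wpM2l //.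
by rewrite (@big_cat_nat _ _ _ k 0 l) //= ?(ltnW kl) // lerDr sumr_ge0.
Qed.

Variable L : R.
Hypothesis L_ge0 : 0 <= L.
Hypothesis K_le : forall i j, (1 <= i)%N -> (1 <= j)%N -> K i j <= L * (rho i * rho j).
Hypothesis J_le : forall i j, (1 <= i)%N -> (1 <= j)%N -> J i j <= L * (rho i * rho j).

Lemma trunc_rate_le (N : nat -> nat -> R) x i : (1 <= i)%N ->
  (forall i j, (1 <= i)%N -> (1 <= j)%N -> N i j <= L * (rho i * rho j)) ->
  (forall i, 0 <= x i) -> trunc_rate N n x i <= L * rho i * rho_tail 1 x.
Proof.
move=> i1 Nle x0; rewrite /trunc_rate /rho_tail mulr_sumr.
apply: ler_sum_nat => j /andP[j1 _].
by rewrite mulrA -(mulrA L) ler_wpM2r // Nle.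
Qed.

Lemma gain_le x i : (forall i, 0 <= x i <= M) ->
  gain x i <= 2^-1 * \sum_(1 <= j < i) K j (i - j)%N * M * M.
Proof.
move=> xM; rewrite /gain ler_wpM2l ?invr_ge0 //.
apply: ler_sum_nat => j /andP[j1 ji].
have K0 : 0 <= K j (i - j)%N by rewrite K_ge0 // subn_gt0.
have /andP[xj0 xjM] := xM j; have /andP[xk0 xkM] := xM (i - j)%N.
by rewrite ler_pM ?mulr_ge0 // ler_wpM2l.
Qed.

(** The gain is a finite sum bounded independently of [n]. The loss rates have no such pointwise
    bound, but they are controlled by [rho_tail 1], whose sum over time is bounded. *)
Lemma drift_norm_le k c i : (1 <= i)%N ->
  `|drift n (X k c) (X k (~~ c)) i| <=
  2^-1 * (\sum_(1 <= j < i) K j (i - j)%N * M * M)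
  + M * L * rho i * (rho_tail 1 (X k c) + rho_tail 1 (X k (~~ c))).
Proof.
move=> i1; rewrite /drift.
have X0 := euler_ge0 k; have XM := euler_le k.
have g0 := gain_ge0 i (X0 c).
have gle := gain_le i (fun j => introT andP (conj (X0 c j) (XM c j))).
have t0 := @trunc_rate_ge0 _ n _ i K_ge0 (X0 c) i1.
have s0 := @trunc_rate_ge0 _ n _ i J_ge0 (X0 (~~ c)) i1.
have tle := trunc_rate_le i1 K_le (X0 c).
have sle := trunc_rate_le i1 J_le (X0 (~~ c)).
have := ler_pM (X0 c i) t0 (XM c i) tle.
have := ler_pM (X0 c i) s0 (XM c i) sle.
have := mulr_ge0 (X0 c i) t0; have := mulr_ge0 (X0 c i) s0.
rewrite ler_norml; move: (gain (X k c) i) g0 gle => gn g0 gle.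
set P := X k c i * _; set Q := X k c i * _ => P0 Q0.
rewrite mulrDr !mulrA => Ple Qle.
by apply/andP; split; lra.
Qed.

(** A large [A] makes the last term small at the price of a steeper slope, which gives
    equicontinuity uniform in [n]. The tail estimate is used with [m = 1] and the weight 1; the
    factor 4 collects [2 * M] from each species. *)
Lemma euler_modulus i A k l c : (0 < i < n)%N -> 0 < A -> (k <= l)%N ->
  `|X l c i - X k c i| <=
  (2^-1 * (\sum_(1 <= j < i) K j (i - j)%N * M * M) + M * L * rho i * (2 * A))
    * ((l - k)%:R * h) + A^-1 * (4 * (M * L * rho i * M)).
Proof.
move=> iN A0 kl; have i1 : (1 <= i)%N by case/andP: iN.
set G := 2^-1 * _; set C := M * L * rho i.
have C0 : 0 <= C by rewrite !mulr_ge0 ?rho_ge0 ?bound_ge0.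
have -> : X l c i - X k c i =
    h * \sum_(k <= p < l) drift n (X p c) (X p (~~ c)) i.
  rewrite /X !(euler_sum h u _ c iN) (@big_cat_nat _ _ _ k 0 l) //= mulrDr.
  by rewrite opprD addrACA subrr add0r addrC addKr.
rewrite normrM (ger0_norm h_ge0).
apply: (@le_trans _ _ (h * \sum_(k <= p < l)
    (G + C * (rho_tail 1 (X p c) + rho_tail 1 (X p (~~ c)))))).
  rewrite ler_wpM2l //; apply: le_trans (ler_norm_sum _ _ _) _.
  by apply: ler_sum => p _; exact: drift_norm_le.
rewrite big_split /= sumr_const_nat -mulr_sumr big_split /= -[G *+ _]mulr_natr.
have T d : h * (\sum_(k <= p < l) rho_tail 1 (X p d)) <=
    A * ((l - k)%:R * h) + A^-1 * (2 * M).
  apply: le_trans (@sum_rho_tail_le (fun=> 1) 1 k l d A _ _ _ _ _) _ => //=.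
    by move=> *; lra.
  rewrite lerD2l !ler_wpM2l ?invr_ge0 ?(ltW A0) //.
  by apply: le_trans (u_le d); rewrite (eq_bigr (u d)) // => ? _; rewrite mul1r.
have := ler_wpM2l C0 (T c); have := ler_wpM2l C0 (T (~~ c)).
set S1 := \sum_(k <= p < l) _; set S2 := \sum_(k <= p < l) _; lra.
Qed.

Lemma euler_first_moment s k c : 0 <= s ->
  (forall i, (1 <= i)%N -> s * i%:R <= rho i) ->
  (s * \sum_(1 <= i < n) i%:R * X k c i) ^+ 2 * (k%:R * h) <= 2 * M.
Proof.
move=> s0 srho.
have M1 l : s * (\sum_(1 <= i < n) i%:R * X l c i) <= rho_tail 1 (X l c).
  rewrite mulr_sumr; apply: ler_sum_nat => i /andP[i1 _].
  by rewrite mulrA ler_wpM2r ?srho //; exact: euler_ge0.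
have -> : (s * \sum_(1 <= i < n) i%:R * X k c i) ^+ 2 * (k%:R * h) =
    h * \sum_(0 <= l < k) (s * \sum_(1 <= i < n) i%:R * X k c i) ^+ 2.
  by rewrite sumr_const_nat subn0 -[_ *+ k]mulr_natr; ring.
have id0 i : 0 <= i%:R * X k c i by rewrite mulr_ge0 //; exact: euler_ge0.
(* The weight [i] is additive, so the moment at step [k] is at most the moment at each earlier step
   [l], which [M1] bounds by the tail. *)
apply: (@le_trans _ _ (h * \sum_(0 <= l < k) rho_tail 1 (X l c) ^+ 2)).
  rewrite ler_wpM2l //; apply: ler_sum_nat => l /andP[_ lk].
  have Q0 : 0 <= rho_tail 1 (X l c) by apply: rho_tail_ge0 => // i; exact: euler_ge0.
  rewrite ler_pXn2r ?nnegrE //; last by rewrite mulr_ge0 ?sumr_ge0.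
  apply: le_trans (M1 l); rewrite ler_wpM2l //.
  by apply: euler_weight_nincr (ltnW lk) => // i j; rewrite natrD.
apply: le_trans (@euler_dissipation (fun=> 1) 1 k c _ _ _ _) _ => //=.
  by move=> *; lra.
rewrite ler_wpM2l //; apply: le_trans (u_le c).
by rewrite (eq_bigr (u c)) // => ? _; rewrite mul1r.
Qed.

End Bounds.
End EulerScheme.

(** * Locally uniform limits of step functions *)

Section Integrals.
Context (R : realType).
Implicit Types (f G : R -> R) (a b c e t : R).

Local Notation mu := (@lebesgue_measure R).

Lemma continuous_integrable_itv f a b : continuous f ->
  mu.-integrable `[a, b] (EFin \o f).
Proof.
move=> cf; apply: continuous_compact_integrable; first exact: segment_compact.
exact: continuous_subspaceT.
Qed.

Lemma continuous_integrable_oo f a b : continuous f ->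
  mu.-integrable `]a, b[ (EFin \o f).
Proof.
move=> cf; apply: (integrableS _ _ _ (continuous_integrable_itv a b cf)) => //.
exact: subset_itv_oo_cc.
Qed.

Lemma Rintegral_oo_cc f a b : continuous f ->
  \int[mu]_(s in `]a, b[) f s = \int[mu]_(s in `[a, b]) f s.
Proof.
move=> cf; rewrite Rintegral_itv_bndo_bndc; last exact: continuous_integrable_oo.
rewrite Rintegral_itv_obnd_cbnd //.
apply: (integrableS _ _ _ (continuous_integrable_itv a b cf)) => //.
exact: subset_itv_oc_cc.
Qed.

(** The integral over an interval is written as a difference of integrals from 0, so that the
    estimates telescope over successive time steps. *)
Lemma Rintegral_close G a b c e : continuous G -> 0 <= a -> a <= b ->
  (forall s, a <= s <= b -> `|c - G s| <= e) ->
  `|c * (b - a) - (\int[mu]_(s in `[0, b]) G s - \int[mu]_(s in `[0, a]) G s)|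
    <= e * (b - a).
Proof.
move=> cG a0 ab Ge.
have iG : mu.-integrable `]a, b] (EFin \o G).
  apply: (integrableS _ _ _ (continuous_integrable_itv a b cG)) => //.
  exact: subset_itv_oc_cc.
have icst (r : R) : mu.-integrable `]a, b] (EFin \o cst r).
  apply: (integrableS _ _ _ (continuous_integrable_itv a b (@cst_continuous _ _ r))) => //.
  exact: subset_itv_oc_cc.
have Icst (r : R) : \int[mu]_(s in `]a, b]) r = r * (b - a).
  rewrite Rintegral_cst //= lebesgue_measure_itv /= lte_fin.
  case: ltP => // ba.
  by have -> : b = a by [apply/eqP; rewrite eq_le ab ba]; rewrite subrr.
rewrite Rintegral_itvB ?bnd_simp //; last exact: continuous_integrable_itv.
rewrite -Icst -RintegralB //; last exact: (icst c).
have iB : mu.-integrable `]a, b] (EFin \o (fun s => c - G s)).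
  exact: integrableB (icst c) iG.
apply: (le_trans (le_normr_Rintegral _ iB)) => //.
rewrite -Icst; apply: le_Rintegral => //; [exact: integrable_norm iB|exact: (icst e)|].
by move=> s /=; rewrite in_itv /= => /andP[/ltW as_ sb]; apply: Ge; rewrite as_.
Qed.

Lemma Rintegral_step_close G (g : nat -> R) (h e : R) k : continuous G -> 0 <= h ->
  (forall l s, (l < k)%N -> l%:R * h <= s <= l.+1%:R * h -> `|g l - G s| <= e) ->
  `|h * \sum_(0 <= l < k) g l - \int[mu]_(s in `[0, k%:R * h]) G s|
    <= e * (k%:R * h).
Proof.
move=> cG h0; elim: k => [|k IH] gG.
  by rewrite big_geq // !mul0r !mulr0 set_itv1 Rintegral_set1 subr0 normr0.
have := IH (fun l s lk => gG l s (ltnW lk)).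
have kh : k%:R * h <= k.+1%:R * h by rewrite ler_wpM2r // ler_nat.
have := @Rintegral_close G _ _ (g k) e cG (mulr_ge0 (ler0n R k) h0) kh
  (fun s => gG k s (ltnSn k)).
have -> : k.+1%:R * h - k%:R * h = h by rewrite -natr1; ring.
rewrite big_nat_recr //= -[k.+1%:R]natr1 => A B.
have -> : h * (\sum_(0 <= i < k) g i + g k) -
    \int[mu]_(s in `[0, (k%:R + 1) * h]) G s =
  (h * \sum_(0 <= l < k) g l - \int[mu]_(s in `[0, k%:R * h]) G s) +
  (g k * h - (\int[mu]_(s in `[0, (k%:R + 1) * h]) G s -
              \int[mu]_(s in `[0, k%:R * h]) G s)) by ring.
have -> : e * ((k%:R + 1) * h) = e * (k%:R * h) + e * h by ring.
by rewrite (le_trans (ler_normD _ _)) // lerD.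
Qed.

End Integrals.

(** * Step functions with vanishing step along an ultrafilter *)

Section StepFunctions.
Context (R : realType) (h : nat -> R).
Context (U : set_system nat) {UU : UltraFilter U}.
Hypothesis h_gt0 : forall n, 0 < h n.
Hypothesis h_cvg : h @ U --> (0 : R).

Local Notation mu := (@lebesgue_measure R).

(* The time step that contains [t]; it is [0] for [t < 0]. *)
Definition step_at n (t : R) : nat := Num.truncn (t / h n).

Lemma step_at_le n t : 0 <= t -> (step_at n t)%:R * h n <= t.
Proof. by move=> t0; rewrite -ler_pdivlMr // truncn_le divr_ge0 // ltW. Qed.

Lemma step_at_gt n t : t < (step_at n t).+1%:R * h n.
Proof. by rewrite -ltr_pdivrMr // truncnS_gt. Qed.

Lemma step_at_mono n s t : s <= t -> (step_at n s <= step_at n t)%N.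
Proof. by move=> st; apply: le_truncn; rewrite ler_pM2r ?invr_gt0. Qed.

Lemma step_at_neg n t : t < 0 -> step_at n t = 0%N.
Proof.
move=> t0; apply/truncn0Pn; rewrite -ltNge (lt_trans _ ltr01) //.
by rewrite pmulr_llt0 ?invr_gt0.
Qed.

Lemma step_at_sub n s t : s <= t ->
  (step_at n t - step_at n s)%:R * h n <= t - s + h n.
Proof.
move=> st; rewrite natrB ?step_at_mono // mulrBl.
have [t0|t0] := ltP t 0.
  by rewrite !step_at_neg ?(le_lt_trans st) // subrr; have := h_gt0 n; lra.
have := step_at_le n t0; have := step_at_gt n s; rewrite -natr1; lra.
Qed.

Lemma step_at_cvg t : 0 <= t -> (fun n => (step_at n t)%:R * h n) @ U --> t.
Proof.
move=> t0; apply/cvgrPdist_le => e e0.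
apply: filterS (cvgr_dist_le _ _ h_cvg _ e0) => n.
rewrite sub0r normrN gtr0_norm // => he.
have := step_at_le n t0; have := step_at_gt n t; rewrite -natr1 => A B.
by rewrite ger0_norm; lra.
Qed.

(* [g n k] is the value of the [n]-th approximation on the time step
   [[k h n, (k + 1) h n]]; these step functions tend to [G] locally uniformly on
   [[0, +oo[]. *)
Definition step_cvg (g : nat -> nat -> R) (G : R -> R) : Prop :=
  [/\ continuous G,
      exists B, (forall n k, `|g n k| <= B) /\ (forall s, `|G s| <= B) &
      forall T e, 0 < e -> \forall n \near U, forall k s,
        k%:R * h n <= s <= k.+1%:R * h n -> s <= T -> `|g n k - G s| <= e].

Lemma step_cvg_at g G t : step_cvg g G -> 0 <= t ->
  (fun n => g n (step_at n t)) @ U --> G t.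
Proof.
move=> [_ _ gG] t0; apply/cvgrPdist_le => e e0.
apply: filterS (gG t e e0) => n; rewrite distrC; apply => //.
by rewrite step_at_le // ltW // step_at_gt.
Qed.

Lemma step_cvg_cst c : step_cvg (fun _ _ => c) (fun=> c).
Proof.
split; first exact: cst_continuous.
  by exists `|c|.
by move=> T e e0; apply: nearW => n k s _ _; rewrite subrr normr0 ltW.
Qed.

Lemma step_cvgD f F g G : step_cvg f F -> step_cvg g G ->
  step_cvg (fun n k => f n k + g n k) (fun s => F s + G s).
Proof.
move=> [cF [B [fB FB]] fF] [cG [C [gC GC]] gG]; split.
- by move=> s; apply: cvgD; [exact: cF|exact: cG].
- by exists (B + C); split=> *; rewrite (le_trans (ler_normD _ _)) // lerD.
- move=> T e e0; have e20 : 0 < e / 2 by rewrite divr_gt0.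
  near=> n => k s ks sT.
  have -> : f n k + g n k - (F s + G s) = (f n k - F s) + (g n k - G s) by ring.
  rewrite (le_trans (ler_normD _ _)) // [leRHS]splitr lerD //.
    by move: k s ks sT; near: n; exact: fF.
  by move: k s ks sT; near: n; exact: gG.
Unshelve. all: end_near. Qed.

Lemma step_cvgM f F g G : step_cvg f F -> step_cvg g G ->
  step_cvg (fun n k => f n k * g n k) (fun s => F s * G s).
Proof.
move=> [cF [B [fB FB]] fF] [cG [C [gC GC]] gG]; split.
- by move=> s; apply: cvgM; [exact: cF|exact: cG].
- by exists (B * C); split=> *; rewrite normrM ler_pM.
- move=> T e e0.
  have B0 : 0 <= B := le_trans (normr_ge0 _) (FB 0).
  have C0 : 0 <= C := le_trans (normr_ge0 _) (GC 0).
  (* The 1 keeps the denominator positive when both bounds vanish. *)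
  pose d := e / (B + C + 1).
  have BC : 0 < B + C + 1 by lra.
  have d0 : 0 < d by rewrite divr_gt0.
  have dE : d * (B + C + 1) = e by rewrite divfK // gt_eqF.
  near=> n => k s ks sT.
  have -> : f n k * g n k - F s * G s =
    f n k * (g n k - G s) + (f n k - F s) * G s by ring.
  apply: (le_trans (ler_normD _ _)); rewrite !normrM.
  apply: (@le_trans _ _ (B * d + d * C)); last by rewrite -dE; lra.
  rewrite lerD // ler_pM //.
    by move: k s ks sT; near: n; exact: gG.
  by move: k s ks sT; near: n; exact: fF.
Unshelve. all: end_near. Qed.

Lemma step_cvgN g G : step_cvg g G -> step_cvg (fun n k => - g n k) (fun s => - G s).
Proof.
move=> gG; have -> : (fun n k => - g n k) = (fun n k => -1 * g n k).
  by apply/funext => n; apply/funext => k; rewrite mulN1r.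
have -> : (fun s => - G s) = (fun s => -1 * G s).
  by apply/funext => s; rewrite mulN1r.
exact: step_cvgM (step_cvg_cst (-1)) gG.
Qed.

Lemma step_cvg_sum (g : nat -> nat -> nat -> R) (G : nat -> R -> R) m p :
  (forall j, step_cvg (g j) (G j)) ->
  step_cvg (fun n k => \sum_(m <= j < p) g j n k) (fun s => \sum_(m <= j < p) G j s).
Proof.
move=> gG; elim: p => [|p IH].
  rewrite (_ : (fun s => _) = fun=> 0).
    by rewrite (_ : (fun n k => _) = fun _ _ => 0); [exact: step_cvg_cst|
      apply/funext => n; apply/funext => k; rewrite big_geq].
  by apply/funext => s; rewrite big_geq.
have [mp|pm] := leqP m p.
  rewrite (_ : (fun s => _) = fun s => \sum_(m <= j < p) G j s + G p s).
    rewrite (_ : (fun n k => _) = fun n k => \sum_(m <= j < p) g j n k + g p n k).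
      exact: step_cvgD.
    by apply/funext => n; apply/funext => k; rewrite big_nat_recr.
  by apply/funext => s; rewrite big_nat_recr.
rewrite (_ : (fun s => _) = fun=> 0).
  by rewrite (_ : (fun n k => _) = fun _ _ => 0); [exact: step_cvg_cst|
    apply/funext => n; apply/funext => k; rewrite big_geq].
by apply/funext => s; rewrite big_geq.
Qed.

(** Up to the last grid point before [t] this is a Riemann sum with uniformly small error. The
    remaining piece is shorter than [h n], and [G] is bounded on it. *)
Lemma step_cvg_integral g G t : step_cvg g G -> 0 <= t ->
  (fun n => h n * \sum_(0 <= l < step_at n t) g n l) @ U -->
  \int[mu]_(s in `]0, t[) G s.
Proof.
move=> [cG [B [gB GB]] gG] t0; rewrite Rintegral_oo_cc //.
apply/cvgrPdist_le => e e0.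
have B0 : 0 <= B := le_trans (normr_ge0 _) (GB 0).
have d0 : 0 < e / (2 * (t + 1)) by rewrite divr_gt0 // mulr_gt0 //; lra.
set d := e / _ in d0.
have dE : d * (t + 1) = e / 2 by rewrite /d; field; lra.
have b0 : 0 < e / (2 * (B + 1)) by rewrite divr_gt0 // mulr_gt0 //; lra.
set b := e / _ in b0.
have bE : b * (B + 1) = e / 2 by rewrite /b; field; lra.
near=> n; rewrite distrC.
have hb : h n <= b.
  by rewrite -[leLHS]gtr0_norm // -normrN -sub0r; near: n; exact: cvgr_dist_le.
have kt := step_at_le n t0; have tk := step_at_gt n t.
set k := step_at n t in kt tk *.
have kh0 : 0 <= k%:R * h n by rewrite mulr_ge0 // ltW.
have := @Rintegral_step_close R G (g n) (h n) d k cG (ltW (h_gt0 n)).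
have H : forall l s, (l < k)%N -> l%:R * h n <= s <= l.+1%:R * h n -> `|g n l - G s| <= d.
  move=> l s lk ls; have sT : s <= t.
    case/andP: ls => _ /le_trans; apply; apply: le_trans kt.
    by rewrite ler_wpM2r ?ler_nat // ltW.
  by move: {lk} l s ls sT; near: n; exact: gG.
move=> /(_ H) {H}.
(* Comparison with the constant 0 bounds the integral of [G] over the incomplete last step. *)
have := @Rintegral_close R G (k%:R * h n) t 0 B cG kh0 kt.
have H s : k%:R * h n <= s <= t -> `|0 - G s| <= B by rewrite sub0r normrN.
move=> /(_ H) {H}; rewrite mul0r sub0r normrN => A1 A2.
move: A1 A2; set I1 := Rintegral _ _ _; set I0 := Rintegral _ _ _; set S := h n * _.
move=> A1 A2.
have -> : S - I1 = (S - I0) - (I1 - I0) by ring.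
apply: (le_trans (ler_normB _ _)).
have : d * (k%:R * h n) <= d * t by rewrite ler_wpM2l // ltW.
have : B * (t - k%:R * h n) <= B * b.
  by rewrite ler_wpM2l //; move: tk; rewrite -natr1; lra.
lra.
Unshelve. all: end_near. Qed.

Lemma near_forall_ltn (Q : nat -> nat -> Prop) p :
  (forall i, \forall n \near U, Q i n) ->
  \forall n \near U, forall i, (i < p)%N -> Q i n.
Proof.
move=> QU; elim: p => [|p IH]; first exact: nearW.
near=> n => i; rewrite ltnS leq_eqVlt => /predU1P[->|ip].
  by near: n; exact: QU.
by move: i ip; near: n.
Unshelve. all: end_near. Qed.

(* Arzela-Ascoli along the ultrafilter: pointwise limits exist by compactness of
   [[0, M]], and the modulus of continuity makes the convergence uniform. *)
Lemma step_cvg_exists (x : nat -> nat -> R) M :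
  (forall n k, 0 <= x n k <= M) ->
  (forall e, 0 < e -> exists2 D, 0 <= D & \forall n \near U,
     forall k l, (k <= l)%N -> `|x n l - x n k| <= e + D * ((l - k)%:R * h n)) ->
  exists G, step_cvg x G.
Proof.
move=> xM xD.
have limx t : exists l : R, (fun n => x n (step_at n t)) @ U --> l.
  set F := (fun n => x n (step_at n t)) @ U.
  have FM : F `[0, M]%classic by apply: nearW => n /=; rewrite in_itv /= xM.
  have [l [_ Fl]] := @segment_compact R 0 M F _ FM.
  exists l => B Bl.
  (* For an ultrafilter a cluster point is a limit: otherwise the complement of [B] would belong to
     the image filter and would have to meet [B]. *)
  have [//|UnB] := in_ultra_setVsetC ((fun n => x n (step_at n t)) @^-1` B) UU.
  by have [y [nBy By]] := Fl (~` B) B UnB Bl.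
have [G GP] := choice limx.
have GM t : 0 <= G t <= M.
  apply/andP; split.
    apply: (ler_cvg_to (cvg_cst 0) (GP t)); apply: nearW => n.
    by have /andP[] := xM n (step_at n t).
  apply: (ler_cvg_to (GP t) (cvg_cst M)); apply: nearW => n.
  by have /andP[] := xM n (step_at n t).
(* The limit inherits the modulus with the same [D]: the steps between [s] and [t] cover at most
   [t - s + h n], and [h n] tends to 0. *)
have GD e : 0 < e -> exists2 D, 0 <= D & (\forall n \near U,
     forall k l, (k <= l)%N -> `|x n l - x n k| <= e + D * ((l - k)%:R * h n)) /\
    forall s t, s <= t -> `|G t - G s| <= e + D * (t - s).
  move=> /xD[D D0 De]; exists D => //; split=> // s t st.
  have c1 : (fun n => `|x n (step_at n t) - x n (step_at n s)|) @ U --> `|G t - G s|.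
    by apply: cvg_norm; apply: cvgB; exact: GP.
  have c2 : (fun n => e + D * (t - s + h n)) @ U --> e + D * (t - s + 0).
    apply: cvgD; first exact: cvg_cst.
    apply: cvgM; first exact: cvg_cst.
    by apply: cvgD => //; exact: cvg_cst.
  rewrite addr0 in c2; apply: (ler_cvg_to c1 c2).
  apply: filterS De => n /(_ _ _ (step_at_mono n st)) H.
  by rewrite (le_trans H) // lerD2l ler_wpM2l // step_at_sub.
have GD' e : 0 < e -> exists2 D, 0 <= D & (\forall n \near U,
     forall k l, (k <= l)%N -> `|x n l - x n k| <= e + D * ((l - k)%:R * h n)) /\
    forall s t, `|G t - G s| <= e + D * `|t - s|.
  move=> /GD[D D0 [A B]]; exists D => //; split=> // s t.
  have [st|/ltW ts] := leP s t; first by rewrite [`|t - s|]ger0_norm ?subr_ge0 // B.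
  by rewrite distrC [`|t - s|]distrC [`|s - t|]ger0_norm ?subr_ge0 // B.
exists G; split.
- move=> t; apply/cvgrPdist_le => e e0.
  have [|D D0 [_ DG]] := GD' (e / 2); first by rewrite divr_gt0.
  have d0 : 0 < e / (2 * (D + 1)) by rewrite divr_gt0 // mulr_gt0 //; lra.
  set d := e / _ in d0.
  have dE : d * (D + 1) = e / 2 by rewrite /d; field; lra.
  near=> s; apply: le_trans (DG s t) _.
  have : D * `|t - s| <= D * d.
    by rewrite ler_wpM2l //; near: s; exact: cvgr_dist_le.
  lra.
- exists M; split=> [n k|s].
    by have /andP[x0 xm] := xM n k; rewrite ger0_norm.
  by have /andP[x0 xm] := GM s; rewrite ger0_norm.
- move=> T e e0.
  (* A grid of mesh [d] with [D * d <= e / 8] has finitely many points up to [T], so convergence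
     holds at all of them at once. Passing through a grid point below [s] costs [3 * (e / 8)] for
     the change of [x n], [e / 8] at the grid point and [2 * (e / 8)] for the change of [G]. *)
  have [|D D0 [xnD DG]] := GD' (e / 8); first by rewrite divr_gt0.
  have d0 : 0 < e / (8 * (D + 1)) by rewrite divr_gt0 // mulr_gt0 //; lra.
  set d := e / _ in d0.
  have dE : d * (D + 1) = e / 8 by rewrite /d; field; lra.
  have Dd : D * d <= e / 8 by lra.
  have e80 : 0 < e / 8 by rewrite divr_gt0.
  pose Q i n := `|x n (step_at n (i%:R * d)) - G (i%:R * d)| <= e / 8.
  have QU i : \forall n \near U, Q i n.
    by rewrite /Q; near=> n; rewrite distrC; near: n; apply: cvgr_dist_le.
  near=> n => k s /andP[ks sk] sT.
  have h0 := h_gt0 n.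
  have hd : h n <= d.
    by rewrite -[leLHS]gtr0_norm // -normrN -sub0r; near: n; exact: cvgr_dist_le.
  have s0 : 0 <= s by apply: le_trans ks; rewrite mulr_ge0 // ltW.
  pose p := Num.truncn (s / d).
  have ps : p%:R * d <= s by rewrite -ler_pdivlMr // truncn_le divr_ge0 // ltW.
  have sp : s < p%:R * d + d.
    have : s < p.+1%:R * d by rewrite -ltr_pdivrMr // truncnS_gt.
    by rewrite -natr1; lra.
  have Qp : Q p n.
    have : (p < (Num.truncn (T / d)).+1)%N.
      by rewrite ltnS; apply: le_truncn; rewrite ler_pM2r ?invr_gt0.
    by move: (p); near: n; exact: near_forall_ltn.
  have pd0 : 0 <= p%:R * d by rewrite mulr_ge0 // ltW.
  have := step_at_le n pd0; have := step_at_gt n (p%:R * d).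
  rewrite /Q in Qp; move: (step_at n (p%:R * d)) Qp => q Qp; rewrite -natr1 => Aq Bq.
  have Dh : D * h n <= e / 8 by apply: le_trans Dd; rewrite ler_wpM2l.
  rewrite -natr1 in sk.
  have xnD' a b : (a <= b)%N -> `|x n b - x n a| <= e / 8 + D * ((b - a)%:R * h n).
    by move: a b; near: n.
  have Hx : `|x n k - x n q| <= 3 * (e / 8).
    have [qk|/ltnW kq] := leqP q k.
      apply: le_trans (xnD' _ _ qk) _; rewrite natrB // mulrBl.
      have : D * (k%:R * h n - q%:R * h n) <= D * (d + h n).
        by rewrite ler_wpM2l //; lra.
      lra.
    rewrite distrC; apply: le_trans (xnD' _ _ kq) _; rewrite natrB // mulrBl.
    have : D * (q%:R * h n - k%:R * h n) <= D * (h n).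
      by rewrite ler_wpM2l //; lra.
    lra.
  have Gx := DG s (p%:R * d).
  have : D * `|p%:R * d - s| <= D * d.
    by rewrite ler_wpM2l // ler_norml; apply/andP; split; lra.
  have -> : x n k - G s = (x n k - x n q) + (x n q - G (p%:R * d)) + (G (p%:R * d) - G s).
    by ring.
  move=> Dps; apply: (le_trans (ler_normD _ _)).
  have := ler_normD (x n k - x n q) (x n q - G (p%:R * d)).
  lra.
Unshelve. all: end_near. Qed.

End StepFunctions.

(** * Passing to the limit *)

Section SummableTail.
Context (R : realType) (u : nat -> R) (M : R).
Hypothesis u_ge0 : forall i, (1 <= i)%N -> 0 <= u i.
Hypothesis u_le : forall n, \sum_(1 <= i < n) u i <= M.

Lemma summable_tail e : 0 < e ->
  exists2 N, (1 <= N)%N & forall n, \sum_(N <= i < n) u i <= e.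
Proof.
move=> e0; pose E := [set \sum_(1 <= i < n) u i | n in [set: nat]].
have supE : has_sup E.
  by split; [exists (\sum_(1 <= i < 0) u i), 0%N|exists M => _ [n _ <-]].
have [_ [N _ <-] EN] := sup_adherent e0 supE.
(* The successor ensures that the tail starts at 1 or later; the partial sum up to [N.+1] is still
   within [e] of the supremum. *)
exists N.+1 => // n; have [nN|Nn] := leqP n N.+1; first by rewrite big_geq // ltW.
have : \sum_(1 <= i < n) u i <= sup E.
  by apply: sup_ubound; [case: supE|exists n].
rewrite (@big_cat_nat _ _ _ N.+1) //=; last exact: ltnW.
have : \sum_(1 <= i < N) u i <= \sum_(1 <= i < N.+1) u i.
  by apply: ler_sum_subnat => // j /andP[j1 _]; exact: u_ge0.
lra.
Qed.

(* The weight [min(i, m) / m] is subadditive and tends to [0] for fixed [i] as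
   [m] grows, so its initial total is small for large [m]. *)
Definition cap_weight m i : R := (minn i m)%:R / m%:R.

Lemma cap_weight_ge0 m i : 0 <= cap_weight m i.
Proof. by rewrite divr_ge0. Qed.

Lemma cap_weightD m i j : cap_weight m (i + j) <= cap_weight m i + cap_weight m j.
Proof.
rewrite /cap_weight -mulrDl ler_wpM2r ?invr_ge0 // -natrD ler_nat; lia.
Qed.

Lemma cap_weight1 m i : (1 <= m)%N -> (m <= i)%N -> cap_weight m i = 1.
Proof.
by move=> m1 /minn_idPr; rewrite /cap_weight => ->; rewrite divff // pnatr_eq0; lia.
Qed.

Lemma cap_weight_merge m i j : (1 <= m)%N -> (m <= i)%N -> (m <= j)%N ->
  cap_weight m (i + j) + 1 <= cap_weight m i + cap_weight m j.
Proof. by move=> m1 mi mj; rewrite !cap_weight1 // (leq_trans mi) ?leq_addr. Qed.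

Lemma sum_cap_weight_small e : 0 < e -> exists2 m0, (1 <= m0)%N &
  forall m n, (m0 <= m)%N -> \sum_(1 <= i < n) cap_weight m i * u i <= e.
Proof.
move=> e0; have e20 : 0 < e / 2 by rewrite divr_gt0.
have [N N1 Ne] := summable_tail e20.
have M0 : 0 <= M by apply: le_trans (u_le 0); rewrite big_geq.
(* Indices below [N] have weight at most [N / m], and this [m0] gives [N / m * M <= e / 2]. From [N]
   on the weight is at most 1 and the tail is at most [e / 2]. *)
pose m0 := maxn N (Num.truncn (2 * N%:R * M / e)).+1.
exists m0; first by rewrite leq_max N1.
move=> m n m0m; have mN : (N <= m)%N by apply: leq_trans m0m; rewrite leq_maxl.
have m_gt0 : (0 < m%:R :> R) by rewrite ltr0n; lia.
have NM : N%:R / m%:R * M <= e / 2.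
  rewrite mulrAC ler_pdivrMr //.
  have : 2 * N%:R * M / e <= m%:R.
    apply: ltW; apply: lt_le_trans (truncnS_gt _) _; rewrite ler_nat.
    by apply: leq_trans m0m; rewrite leq_maxr.
  by rewrite ler_pdivrMr //; lra.
apply: (@le_trans _ _ (\sum_(1 <= i < maxn n N) cap_weight m i * u i)).
  apply: ler_sum_subnat; last exact: leq_maxl.
  by move=> j /andP[j1 _]; rewrite mulr_ge0 ?cap_weight_ge0 ?u_ge0.
rewrite (@big_cat_nat _ _ _ N) ?leq_maxr //= [leRHS]splitr; apply: lerD.
  apply: le_trans NM; apply: (@le_trans _ _ (N%:R / m%:R * \sum_(1 <= i < N) u i)).
    rewrite mulr_sumr; apply: ler_sum_nat => i /andP[i1 iN].
    rewrite ler_wpM2r ?u_ge0 // ler_wpM2r ?invr_ge0 // ler_nat; lia.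
  by rewrite ler_wpM2l // divr_ge0.
apply: le_trans (Ne (maxn n N)); apply: ler_sum_nat => i /andP[Ni _].
rewrite -[leRHS]mul1r ler_wpM2r ?u_ge0 ?(leq_trans N1) //.
by rewrite ler_pdivrMr // mul1r ler_nat geq_minr.
Qed.

End SummableTail.

(** * Compactness of the approximations and their limit *)

Section Existence.
Context (R : realType) (K J : nat -> nat -> R).
Hypothesis K_ge0 : forall i j, (1 <= i)%N -> (1 <= j)%N -> 0 <= K i j.
Hypothesis K_sym : forall i j, (1 <= i)%N -> (1 <= j)%N -> K i j = K j i.
Hypothesis J_ge0 : forall i j, (1 <= i)%N -> (1 <= j)%N -> 0 <= J i j.
Variables (rho : nat -> R) (s L : R).
Hypothesis rho_ge0 : forall i, (1 <= i)%N -> 0 <= rho i.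
Hypothesis rho_le : forall i j, (1 <= i)%N -> (1 <= j)%N -> rho i * rho j <= K i j.
Hypothesis L_ge0 : 0 <= L.
Hypothesis K_le : forall i j, (1 <= i)%N -> (1 <= j)%N -> K i j <= L * (rho i * rho j).
Hypothesis J_le : forall i j, (1 <= i)%N -> (1 <= j)%N -> J i j <= L * (rho i * rho j).
Hypothesis s_gt0 : 0 < s.
Hypothesis s_le : forall i, (1 <= i)%N -> s * i%:R <= rho i.
Variables (u : bool -> nat -> R) (M : R).
Hypothesis u_ge0 : forall c i, (1 <= i)%N -> 0 <= u c i.
Hypothesis u_le : forall c n, \sum_(1 <= i < n) u c i <= M.

Lemma mass_ge0 : 0 <= M.
Proof. by apply: le_trans (u_le true 0); rewrite big_geq. Qed.

Let cfl n := \sum_(1 <= i < n) \sum_(1 <= j < n) (K i j + J i j) * M.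

Lemma cfl_ge0 n : 0 <= cfl n.
Proof.
rewrite /cfl big_nat sumr_ge0 // => i /andP[i1 _].
rewrite big_nat sumr_ge0 // => j /andP[j1 _].
by rewrite mulr_ge0 ?mass_ge0 // addr_ge0 ?K_ge0 ?J_ge0.
Qed.

(* Small enough for one Euler step to preserve nonnegativity. *)
Definition time_step n : R := (n.+1%:R + cfl n)^-1.

Lemma time_step_gt0 n : 0 < time_step n.
Proof. by rewrite invr_gt0 ltr_wpDr ?cfl_ge0. Qed.

Lemma time_step_cfl n : time_step n * cfl n <= 1.
Proof.
have c0 := cfl_ge0 n; have n0 : 0 < n.+1%:R + cfl n by rewrite ltr_wpDr.
by rewrite mulrC ler_pdivrMr // mul1r lerDr.
Qed.

Lemma time_step_cvg : time_step @ \oo --> (0 : R).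
Proof.
apply: (@squeeze_cvgr _ _ _ _ (fun=> 0) (@harmonic R)); last exact: cvg_harmonic.
  apply: nearW => n; rewrite ltW ?time_step_gt0 //= /harmonic.
  by rewrite lef_pV2 ?posrE ?lerDl ?cfl_ge0 // ltr_wpDr ?cfl_ge0.
exact: cvg_cst.
Qed.

Let X n k c i := euler K J n (time_step n) u k c i.

Let hge n := ltW (time_step_gt0 n).

Lemma approx_ge0 n k c i : 0 <= X n k c i.
Proof. exact: (euler_ge0 K_ge0 K_sym J_ge0 (hge n) u_ge0 (u_le^~ n) (time_step_cfl n)). Qed.

Lemma approx_le n k c i : X n k c i <= M.
Proof. exact: (euler_le K_ge0 K_sym J_ge0 (hge n) u_ge0 (u_le^~ n) (time_step_cfl n)). Qed.

Lemma approx_sum_le n k c : \sum_(1 <= i < n) X n k c i <= M.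
Proof. exact: (euler_sum_le K_ge0 K_sym J_ge0 (hge n) u_ge0 (u_le^~ n) (time_step_cfl n)). Qed.

Lemma approx_tail_small c T d : 0 <= T -> 0 < d -> exists2 m0, (1 <= m0)%N &
  forall m n k, (m0 <= m)%N -> k%:R * time_step n <= T ->
  time_step n * (\sum_(0 <= l < k) rho_tail n rho m (X n l c)) <= d.
Proof.
(* First [A] makes the time term at most [d / 2]. Then an initial weight of at most [A * d / 4]
   makes the other term at most [d / 2], for every [n]. *)
move=> T0 d0; have A0 : 0 < d / (2 * (T + 1)) by rewrite divr_gt0 // mulr_gt0 //; lra.
set A := d / _ in A0.
have AE : A * (T + 1) = d / 2 by rewrite /A; field; lra.
have e0 : 0 < A * d / 4 by rewrite divr_gt0 // mulr_gt0.
have [m0 m01 m0P] := sum_cap_weight_small (u_ge0 c) (u_le c) e0.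
exists m0 => // m n k m0m kT; have m1 : (1 <= m)%N := leq_trans m01 m0m.
have := sum_rho_tail_le K_ge0 K_sym J_ge0 (hge n) u_ge0 (u_le^~ n) (time_step_cfl n)
  rho_ge0 rho_le 0 k c m1 (@cap_weight_ge0 R m) (@cap_weightD R m)
  (fun i j => @cap_weight_merge R m i j m1) A0.
rewrite subn0 => /le_trans; apply.
have : A * (k%:R * time_step n) <= A * T by rewrite ler_wpM2l // ltW.
have : A^-1 * (2 * \sum_(1 <= i < n) cap_weight R m i * u c i) <= A^-1 * (2 * (A * d / 4)).
  by rewrite ler_wpM2l ?invr_ge0 ?(ltW A0) // ler_wpM2l // m0P.
have -> : A^-1 * (2 * (A * d / 4)) = d / 2 by field; rewrite gt_eqF.
lra.
Qed.

(** The case of the weight 1, [m = 1] and parameter [A = 1]; the bound does not depend on [n]. *)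
Lemma approx_tail_bounded c T n k : k%:R * time_step n <= T ->
  time_step n * (\sum_(0 <= l < k) rho_tail n rho 1 (X n l c)) <= T + 2 * M.
Proof.
move=> kT.
have := @sum_rho_tail_le _ _ _ K_ge0 K_sym J_ge0 _ _ _ _ (hge n) u_ge0 (u_le^~ n)
  (time_step_cfl n) _ rho_ge0 rho_le (fun=> 1) 1 0 k c 1 isT (fun=> ler01).
rewrite subn0 mul1r invr1 mul1r => H; apply: le_trans (H _ _ _) _ => //=.
- by move=> *; rewrite lerDl.
- rewrite lerD // ler_wpM2l //; apply: le_trans (u_le c n).
  by rewrite (eq_bigr (u c)) // => ? _; rewrite mul1r.
Qed.

Lemma approx_modulus c i e : 0 < e -> exists2 D, 0 <= D & \forall n \near \oo,
  forall k l, (k <= l)%N ->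
  `|X n l c i - X n k c i| <= e + D * ((l - k)%:R * time_step n).
Proof.
move=> e0; case: i => [|i].
  (* The approximations vanish identically at index 0. *)
  exists 0 => //; apply: nearW => n k l _.
  by rewrite /X !euler_out // subrr normr0 mul0r addr0 ltW.
pose C := M * L * rho i.+1.
have C0 : 0 <= C by rewrite !mulr_ge0 ?mass_ge0 ?rho_ge0.
have CM : 0 <= C * M by rewrite mulr_ge0 ?mass_ge0.
(* [A] is large enough for the constant term of [euler_modulus] to be at most [e]; its slope is then
   the required [D]. *)
have A0 : 0 < (4 * (C * M) + 1) / e by rewrite divr_gt0 //; lra.
set A := (_ / e) in A0.
have Ae : A^-1 * (4 * (C * M)) <= e.
  rewrite mulrC ler_pdivrMr // /A [e * _]mulrC divfK ?gt_eqF //; lra.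
exists (2^-1 * (\sum_(1 <= j < i.+1) K j (i.+1 - j)%N * M * M) + C * (2 * A)).
  rewrite addr_ge0 //; last by rewrite mulr_ge0 // mulr_ge0 // ltW.
  rewrite mulr_ge0 ?invr_ge0 // big_nat sumr_ge0 // => j /andP[j1 ji].
  by rewrite !mulr_ge0 ?mass_ge0 // K_ge0 // subn_gt0.
exists i.+2 => // n /= ni k l kl.
have iN : (0 < i.+1 < n)%N by [].
have := euler_modulus K_ge0 K_sym J_ge0 (hge n) u_ge0 (u_le^~ n) (time_step_cfl n)
  rho_ge0 rho_le L_ge0 K_le J_le c iN A0 kl.
move=> /le_trans; apply; rewrite -/C addrC lerD //.
Qed.

Lemma approx_first_moment n k c :
  (s * \sum_(1 <= i < n) i%:R * X n k c i) ^+ 2 * (k%:R * time_step n) <= 2 * M.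
Proof.
exact: (euler_first_moment K_ge0 K_sym J_ge0 (hge n) u_ge0 (u_le^~ n)
  (time_step_cfl n) rho_ge0 rho_le k c (ltW s_gt0) s_le).
Qed.

(** The gain does not involve the truncation, so the two drifts differ only by the parts [j >= m] of
    the two loss sums. *)
Lemma drift_trunc_close m n k c i : (1 <= i)%N -> (1 <= m)%N -> (m <= n)%N ->
  `|drift K J n (X n k c) (X n k (~~ c)) i - drift K J m (X n k c) (X n k (~~ c)) i| <=
  M * L * rho i * (rho_tail n rho m (X n k c) + rho_tail n rho m (X n k (~~ c))).
Proof.
move=> i1 m1 mn; rewrite /drift.
have split (N : nat -> nat -> R) x : trunc_rate N n x i =
    trunc_rate N m x i + \sum_(m <= j < n) N i j * x j.
  by rewrite /trunc_rate (@big_cat_nat _ _ _ m).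
rewrite !split; set G := gain _ _ _; set x := X n k c i.
set A := trunc_rate _ _ _ _; set B := trunc_rate _ _ _ _.
set P := \sum_(m <= j < n) _; set Q := \sum_(m <= j < n) _.
have -> : G - x * (A + P) - x * (B + Q) - (G - x * A - x * B) = - (x * (P + Q)) by ring.
have tail (N : nat -> nat -> R) d :
    (forall i j, (1 <= i)%N -> (1 <= j)%N -> 0 <= N i j) ->
    (forall i j, (1 <= i)%N -> (1 <= j)%N -> N i j <= L * (rho i * rho j)) ->
    0 <= \sum_(m <= j < n) N i j * X n k d j <= L * rho i * rho_tail n rho m (X n k d).
  move=> N0 NL; apply/andP; split.
    rewrite big_nat sumr_ge0 // => j /andP[mj _].
    by rewrite mulr_ge0 ?approx_ge0 // N0 // (leq_trans m1).
  rewrite /rho_tail mulr_sumr; apply: ler_sum_nat => j /andP[mj _].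
  by rewrite mulrA -(mulrA L) ler_wpM2r ?approx_ge0 // NL // (leq_trans m1).
have /andP[P0 PL] := tail K c K_ge0 K_le.
have /andP[Q0 QL] := tail J (~~ c) J_ge0 J_le.
rewrite normrN ger0_norm; last by rewrite mulr_ge0 ?approx_ge0 ?addr_ge0.
rewrite -!(mulrA M) ler_pM ?approx_ge0 ?addr_ge0 ?approx_le //.
by rewrite mulrDr lerD.
Qed.

(* The tail [j >= m] of the rate sums is uniformly small in the approximations,
   so only finite sums have to be passed to the limit; [m] is sent to infinity
   afterwards. *)
Lemma limit_solution : exists a : bool -> nat -> R -> R,
  [/\ (forall c i, continuous (a c i)) /\ (forall c i t, 0 <= t -> 0 <= a c i t),
      forall c m t, 0 <= t -> \sum_(1 <= i < m) a c i t <= M,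
      forall c t, 0 < t -> exists C, forall m, \sum_(1 <= i < m) i%:R * a c i t <= C,
      forall c T, 0 <= T -> exists C, forall m,
        \int[lebesgue_measure]_(r in `]0, T[) (\sum_(1 <= j < m) rho j * a c j r) <= C &
      forall c i t, (1 <= i)%N -> 0 <= t ->
        (fun m => \int[lebesgue_measure]_(r in `]0, t[)
           drift K J m (fun j => a c j r) (fun j => a (~~ c) j r) i) @ \oo
        --> a c i t - u c i].
Proof.
(* One ultrafilter finer than [\oo] serves all components of both species, so no diagonal extraction
   is made. *)
have [U [UU Uoo]] := @ultraFilterLemma nat \oo _.
have h_cvg : time_step @ U --> (0 : R).
  by apply: cvg_trans time_step_cvg => A; exact: Uoo.
have Xlim (ci : bool * nat) : exists G, step_cvg time_step U (fun n k => X n k ci.1 ci.2) G.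
  apply: (step_cvg_exists time_step_gt0 h_cvg (M := M)) => [n k|e e0].
    by rewrite approx_ge0 approx_le.
  have [D D0 De] := approx_modulus ci.1 ci.2 e0; exists D => //; exact: Uoo.
have [f fP] := choice Xlim; pose a c i := f (c, i).
have aP c i : step_cvg time_step U (fun n k => X n k c i) (a c i) by exact: fP (c, i).
have at_cvg g G t := @step_cvg_at R time_step U UU time_step_gt0 g G t.
have int_cvg g G t := @step_cvg_integral R time_step U UU time_step_gt0 h_cvg g G t.
have nearU (P : nat -> Prop) m : (forall n, (m <= n)%N -> P n) -> \forall n \near U, P n.
  by move=> mP; apply: Uoo; exists m.
have sumP (w : nat -> R) c m : step_cvg time_step U
    (fun n k => \sum_(1 <= i < m) w i * X n k c i) (fun t => \sum_(1 <= i < m) w i * a c i t).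
  by apply: step_cvg_sum => j; apply: step_cvgM; [exact: step_cvg_cst|exact: aP].
have driftP c i m : step_cvg time_step U
    (fun n k => drift K J m (X n k c) (X n k (~~ c)) i)
    (fun t => drift K J m (fun j => a c j t) (fun j => a (~~ c) j t) i).
  apply: step_cvgD; first apply: step_cvgD.
  - apply: step_cvgM; first exact: step_cvg_cst.
    apply: step_cvg_sum => j; apply: step_cvgM; last exact: aP.
    by apply: step_cvgM; [exact: step_cvg_cst|exact: aP].
  - apply: step_cvgN; apply: step_cvgM; first exact: aP.
    by apply: step_cvg_sum => j; apply: step_cvgM; [exact: step_cvg_cst|exact: aP].
  - apply: step_cvgN; apply: step_cvgM; first exact: aP.
    by apply: step_cvg_sum => j; apply: step_cvgM; [exact: step_cvg_cst|exact: aP].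
have sub_sum (F : nat -> R) n m : (forall i, 0 <= F i) -> (m <= n)%N ->
    \sum_(1 <= i < m) F i <= \sum_(1 <= i < n) F i.
  by move=> F0; apply: ler_sum_subnat.
exists a; split.
- split=> [c i|c i t t0]; first by have [] := aP c i.
  apply: (ler_cvg_to (cvg_cst 0) (at_cvg _ _ _ (aP c i) t0)).
  by apply: nearW => n; exact: approx_ge0.
- move=> c m t t0; have wP := at_cvg _ _ _ (sumP (fun=> 1) c m) t0.
  rewrite (eq_bigr (fun i => 1 * a c i t)); last by move=> i _; rewrite mul1r.
  apply: (ler_cvg_to wP (cvg_cst M)).
  apply: (nearU _ m) => n mn; apply: le_trans (approx_sum_le n (step_at time_step n t) c).
  rewrite (eq_bigr (X n (step_at time_step n t) c)); last by move=> i _; rewrite mul1r.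
  by apply: sub_sum => // i; exact: approx_ge0.
(* The witness comes from [(s * y) ^+ 2 <= 2 * M / t] and [z <= 1 + z ^+ 2]. *)
- move=> c t t0; exists ((1 + 2 * M / t) / s) => m.
  set y := \sum_(1 <= i < m) _; have wP := at_cvg _ _ _ (sumP (fun i => i%:R) c m) (ltW t0).
  have ty : (s * y) ^+ 2 * t <= 2 * M.
    pose Y n := s * \sum_(1 <= i < m) i%:R * X n (step_at time_step n t) c i.
    have c2 : Y @ U --> s * y by apply: cvgM => //; exact: cvg_cst.
    have c1 : (fun n => Y n * Y n * ((step_at time_step n t)%:R * time_step n)) @ U
        --> s * y * (s * y) * t.
      apply: cvgM; first exact: cvgM.
      by have := @step_at_cvg _ _ _ UU time_step_gt0 h_cvg t (ltW t0).
    rewrite expr2; apply: (ler_cvg_to c1 (cvg_cst (2 * M))).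
    apply: (nearU _ m) => n mn; rewrite -expr2 /Y; set k := step_at _ _ _.
    apply: le_trans (approx_first_moment n k c).
    have Y0 p : 0 <= \sum_(1 <= i < p) i%:R * X n k c i.
      by apply: sumr_ge0 => i _; rewrite mulr_ge0 ?approx_ge0.
    rewrite ler_wpM2r ?mulr_ge0 ?hge // ler_pXn2r ?nnegrE ?mulr_ge0 ?(ltW s_gt0) //.
    by rewrite ler_wpM2l ?(ltW s_gt0) // sub_sum // => i; rewrite mulr_ge0 ?approx_ge0.
  rewrite ler_pdivlMr // [y * s]mulrC.
  have : (s * y) ^+ 2 <= 2 * M / t by rewrite ler_pdivlMr.
  by have := sqr_ge0 (s * y - 1); have := sqr_ge0 (s * y); rewrite !expr2; lra.
- move=> c T T0; exists (T + 2 * M) => m.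
  have c1 := int_cvg _ _ _ (sumP rho c m) T0.
  apply: (ler_cvg_to c1 (cvg_cst (T + 2 * M))).
  apply: (nearU _ m) => n mn.
  apply: le_trans (approx_tail_bounded c (step_at_le time_step_gt0 n T0)).
  rewrite ler_wpM2l ?hge //; apply: ler_sum_nat => l _.
  apply: ler_sum_subnat => // j /andP[j1 _].
  by rewrite mulr_ge0 ?rho_ge0 ?approx_ge0.
- move=> c i t i1 t0; apply/cvgrPdist_le => e e0.
  pose C := M * L * rho i.
  have C0 : 0 <= C by rewrite !mulr_ge0 ?mass_ge0 ?rho_ge0.
  have d0 : 0 < e / (2 * C + 1) by rewrite divr_gt0 //; lra.
  set d := e / _ in d0.
  have dE : C * (d + d) <= e.
    have : d * (2 * C + 1) = e by rewrite divfK // gt_eqF //; lra.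
    lra.
  have [m1 m11 m1P] := approx_tail_small c t0 d0.
  have [m2 m21 m2P] := approx_tail_small (~~ c) t0 d0.
  exists (maxn m1 m2) => // m /=; rewrite geq_max => /andP[mm1 mm2].
  (* With [m] fixed, [n] goes to the limit first. In the scheme [X - u] is exactly the Riemann sum
     of the drift truncated at [n]; replacing this by the drift truncated at [m] costs at most
     [C * (d + d)]. *)
  have c1 : (fun n => `|X n (step_at time_step n t) c i - u c i
      - time_step n * \sum_(0 <= l < step_at time_step n t)
          drift K J m (X n l c) (X n l (~~ c)) i|) @ U -->
      `|a c i t - u c i - \int[lebesgue_measure]_(r in `]0, t[)
           drift K J m (fun j => a c j r) (fun j => a (~~ c) j r) i|.
    apply: cvg_norm; apply: cvgB; last exact: int_cvg (driftP c i m) t0.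
    by apply: cvgB; [exact: at_cvg (aP c i) t0|exact: cvg_cst].
  apply: (ler_cvg_to c1 (cvg_cst e)).
  (* Size [i] evolves in the scheme only for [n > i], and the comparison of drifts needs
     [m <= n]. *)
  apply: (nearU _ (maxn m i.+1)) => n; rewrite geq_max => /andP[mn iN].
  have iN' : (0 < i < n)%N by rewrite i1.
  set k := step_at _ _ _; rewrite {1}/X (euler_sum K J (time_step n) u k c iN').
  rewrite [_ + _ - u c i]addrAC subrr add0r.
  have kt : k%:R * time_step n <= t by exact: (step_at_le time_step_gt0 n t0).
  rewrite -mulrBr -sumrB normrM (gtr0_norm (time_step_gt0 n)).
  have H : `|\sum_(0 <= l < k) (drift K J n (X n l c) (X n l (~~ c)) i -
         drift K J m (X n l c) (X n l (~~ c)) i)| <=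
     \sum_(0 <= l < k) C * (rho_tail n rho m (X n l c) + rho_tail n rho m (X n l (~~ c))).
    apply: le_trans (ler_norm_sum _ _ _) _; apply: ler_sum => l _.
    by apply: drift_trunc_close => //; exact: leq_trans mm1.
  apply: le_trans (ler_wpM2l (hge n) H) _.
  rewrite -mulr_sumr big_split /= mulrCA; apply: le_trans dE.
  by rewrite ler_wpM2l // mulrDr lerD // ?m1P ?m2P.
Qed.

End Existence.

(** * Integrals of the rate sums *)

Section NonnegativeSeries.
Context (R : realType) (f : nat -> R -> R) (t : R).
Hypothesis f_cont : forall j, continuous (f j).
Hypothesis f_ge0 : forall j s, (1 <= j)%N -> s \in `]0, t[ -> 0 <= f j s.

Local Notation mu := (@lebesgue_measure R).
Let F (s : R) : \bar R := (\sum_(1 <= j <oo) (f j s)%:E)%E.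
Let Fm m (s : R) : R := \sum_(1 <= j < m) f j s.

Lemma continuous_sum_nat m : continuous (Fm m).
Proof.
rewrite /Fm; elim: m => [|m IH] s.
  rewrite (_ : (fun s => _) = fun=> 0); first exact: cst_continuous.
  by apply/funext => r; rewrite big_geq.
case: m IH => [|m] IH.
  rewrite (_ : (fun s => _) = fun=> 0); first exact: cst_continuous.
  by apply/funext => r; rewrite big_geq.
rewrite (_ : (fun s => _) = fun s => \sum_(1 <= j < m.+1) f j s + f m.+1 s).
  by apply: cvgD; [exact: IH|exact: f_cont].
by apply/funext => r; rewrite big_nat_recr.
Qed.

Let FE s : F s = limn (fun m => (Fm m s)%:E).
Proof. by congr (limn _); apply/funext => m; rewrite sumEFin. Qed.

Let Fm_mono s : s \in `]0, t[ ->
  {homo (fun m => (Fm m s)%:E) : n m / (n <= m)%N >-> (n <= m)%E}.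
Proof.
move=> st n m nm; rewrite lee_fin; apply: ler_sum_subnat => // j /andP[j1 _].
exact: f_ge0.
Qed.

Lemma series_ge0 s : s \in `]0, t[ -> (0 <= F s)%E.
Proof.
by move=> st; apply: nneseries_ge0 => j j1 _; rewrite lee_fin f_ge0.
Qed.

Let Fm_int m : mu.-integrable `]0, t[ (EFin \o Fm m).
Proof. exact: continuous_integrable_oo (@continuous_sum_nat m). Qed.

Lemma series_integral_cvg :
  (fun m => (\int[mu]_(s in `]0, t[) Fm m s)%:E) @ \oo -->
  (\int[mu]_(s in `]0%R, t[) F s)%E.
Proof.
have -> : (fun m => (\int[mu]_(s in `]0, t[) Fm m s)%:E) =
    (fun m => \int[mu]_(s in `]0%R, t[) (Fm m s)%:E)%E.
  apply/funext => m; rewrite fineK //.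
  by apply: integrable_fin_num => //; exact: Fm_int.
rewrite (_ : F = fun s => limn (fun m => (Fm m s)%:E)); last exact/funext.
apply: cvg_monotone_convergence => //.
  by move=> m; exact: (measurable_int mu (Fm_int m)).
move=> m s st; rewrite lee_fin /Fm big_nat sumr_ge0 // => j /andP[j1 _].
exact: f_ge0.
Qed.

(** By monotone convergence the integral of the series is the limit of the integrals of its partial
    sums, hence at most [C]. *)
Lemma integrable_series C :
  (forall m, \int[mu]_(s in `]0, t[) Fm m s <= C) -> mu.-integrable `]0, t[ F.
Proof.
move=> FC; apply/integrableP; split.
  apply: (measurable_realfun.emeasurable_fun_cvg (fun m s => (Fm m s)%:E)) => [m|s st].
    exact: (measurable_int mu (Fm_int m)).
  by rewrite FE; apply: ereal_nondecreasing_is_cvgn; apply: Fm_mono.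
have -> : (\int[mu]_(s in `]0%R, t[) `|F s|)%E = (\int[mu]_(s in `]0%R, t[) F s)%E.
  by apply: eq_integral => s /set_mem st; rewrite gee0_abs // series_ge0.
apply: le_lt_trans (ltry C).
rewrite -(cvg_lim _ series_integral_cvg) //; apply: lime_le.
  by apply/cvg_ex; eexists; exact: series_integral_cvg.
by apply: nearW => m; rewrite lee_fin.
Qed.

Lemma series_Rintegral_cvg : mu.-integrable `]0, t[ F ->
  (fun m => \int[mu]_(s in `]0, t[) Fm m s) @ \oo -->
  fine (\int[mu]_(s in `]0%R, t[) F s)%E.
Proof.
move=> Fint; have := series_integral_cvg.
rewrite -{1}[X in _ --> X -> _]fineK; last exact: integrable_fin_num.
by move=> /fine_cvg.
Qed.

End NonnegativeSeries.

(** * Weighted norms and partial sums *)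

Section Norms.
Context (R : realType).

Lemma Xnorm_lt_pinfty (p : R) (x : nat -> R) C :
  (forall m, \sum_(1 <= i < m) i%:R `^ p * `|x i| <= C) -> (Xnorm p x < +oo)%E.
Proof.
move=> xC; apply: le_lt_trans (ltry C); apply: lime_le.
  by apply: is_cvg_nneseries => i _ _; rewrite lee_fin mulr_ge0 ?powR_ge0.
by apply: nearW => m; rewrite sumEFin lee_fin.
Qed.

Lemma Xpos0_sum_le (x : nat -> R) : Xpos 0 x ->
  exists M, forall n, \sum_(1 <= i < n) x i <= M.
Proof.
move=> [xfin x0]; exists (fine (Xnorm 0 x)) => n.
have x0E i : (1 <= i)%N -> true -> (0 <= (i%:R `^ 0 * `|x i|)%:E)%E.
  by move=> _ _; rewrite lee_fin mulr_ge0 ?powR_ge0.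
rewrite -lee_fin fineK; last by rewrite ge0_fin_numE //; exact: nneseries_ge0.
apply: le_trans (nneseries_lim_ge n x0E); rewrite sumEFin lee_fin.
by apply: ler_sum_nat => i /andP[i1 _]; rewrite powRr0 mul1r ler_norm.
Qed.

End Norms.

(** * The integral equation for the limit *)

Section LimitIsSolution.
Context (R : realType) (K J : nat -> nat -> R).
Hypothesis K_ge0 : forall i j, (1 <= i)%N -> (1 <= j)%N -> 0 <= K i j.
Hypothesis J_ge0 : forall i j, (1 <= i)%N -> (1 <= j)%N -> 0 <= J i j.
Variables (rho : nat -> R) (L M t C : R) (a : bool -> nat -> R -> R).
Hypothesis rho_ge0 : forall i, (1 <= i)%N -> 0 <= rho i.
Hypothesis L_ge0 : 0 <= L.
Hypothesis K_le : forall i j, (1 <= i)%N -> (1 <= j)%N -> K i j <= L * (rho i * rho j).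
Hypothesis J_le : forall i j, (1 <= i)%N -> (1 <= j)%N -> J i j <= L * (rho i * rho j).
Hypothesis a_cont : forall c i, continuous (a c i).
Hypothesis a_ge0 : forall c i s, s \in `]0, t[ -> 0 <= a c i s.
Hypothesis a_le : forall c i s, (1 <= i)%N -> s \in `]0, t[ -> a c i s <= M.
Hypothesis C_ge : forall c m,
  \int[lebesgue_measure]_(r in `]0, t[) (\sum_(1 <= j < m) rho j * a c j r) <= C.

Local Notation mu := (@lebesgue_measure R).

Lemma continuousZ_fun (k : R) (g : R -> R) : continuous g -> continuous (fun s => k * g s).
Proof. by move=> cg s; apply: cvgM; [exact: cvg_cst|exact: cg]. Qed.

(** The factor [w] lets one estimate serve twice: [w = 1] for the integrability of the rate sums,
    and [w] equal to a density for the loss terms. *)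
Lemma weighted_rate_integral_le (N : nat -> nat -> R) (w : R -> R) B c i m :
  (1 <= i)%N -> continuous w -> (forall s, s \in `]0, t[ -> 0 <= w s <= B) -> 0 <= B ->
  (forall i j, (1 <= i)%N -> (1 <= j)%N -> N i j <= L * (rho i * rho j)) ->
  (forall i j, (1 <= i)%N -> (1 <= j)%N -> 0 <= N i j) ->
  \int[mu]_(s in `]0, t[) (\sum_(1 <= j < m) w s * (N i j * a c j s)) <= B * (L * rho i) * C.
Proof.
move=> i1 cw wB B0 NL N0; have k0 : 0 <= B * (L * rho i) by rewrite !mulr_ge0 ?rho_ge0.
apply: le_trans (ler_wpM2l k0 (C_ge c m)).
have c1 : continuous (fun s => \sum_(1 <= j < m) rho j * a c j s).
  by apply: continuous_sum_nat => j; exact: continuousZ_fun.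
have c2 : continuous (fun s => \sum_(1 <= j < m) w s * (N i j * a c j s)).
  apply: continuous_sum_nat => j s; apply: cvgM; first exact: cw.
  exact: continuousZ_fun.
rewrite -RintegralZl //; last exact: continuous_integrable_oo.
apply: le_Rintegral => //.
- exact: continuous_integrable_oo.
- exact: continuous_integrable_oo (continuousZ_fun c1).
- move=> s st; rewrite mulr_sumr; apply: ler_sum_nat => j /andP[j1 _].
  have /andP[w0 wle] := wB s st; have as0 := a_ge0 c j st.
  have -> : B * (L * rho i) * (rho j * a c j s) = B * (L * (rho i * rho j) * a c j s) by ring.
  by rewrite ler_pM ?mulr_ge0 ?N0 // ler_wpM2r ?NL.
Qed.

Lemma weighted_rate_cont (N : nat -> nat -> R) (w : R -> R) c i j :
  continuous w -> continuous (fun s => w s * (N i j * a c j s)).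
Proof. by move=> cw s; apply: cvgM; [exact: cw|exact: continuousZ_fun]. Qed.

Lemma rate_sum_integrable (N : nat -> nat -> R) c i : (1 <= i)%N ->
  (forall i j, (1 <= i)%N -> (1 <= j)%N -> N i j <= L * (rho i * rho j)) ->
  (forall i j, (1 <= i)%N -> (1 <= j)%N -> 0 <= N i j) ->
  mu.-integrable `]0, t[ (rate_sum N (a c) i).
Proof.
move=> i1 NL N0; apply: (@integrable_series _ _ _ _ _ (1 * (L * rho i) * C)).
- by move=> j; exact: continuousZ_fun.
- by move=> j s j1 st; rewrite mulr_ge0 ?N0 ?a_ge0.
- move=> m.
  have -> : \int[mu]_(s in `]0, t[) (\sum_(1 <= j < m) N i j * a c j s) =
      \int[mu]_(s in `]0, t[) (\sum_(1 <= j < m) 1 * (N i j * a c j s)).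
    by apply: eq_Rintegral => s _; apply: eq_bigr => j _; rewrite mul1r.
  apply: (@weighted_rate_integral_le N (fun=> 1)) => //; first exact: cst_continuous.
  by move=> s _; rewrite ler01 lexx.
Qed.

(** The integrals of the truncated drifts also converge, by monotone convergence in each loss sum,
    to the integral of the full right-hand side; limits are unique. *)
Lemma ca_rhs_integral c i (l : R) : (1 <= i)%N ->
  (fun m => \int[mu]_(r in `]0, t[)
     drift K J m (fun j => a c j r) (fun j => a (~~ c) j r) i) @ \oo --> l ->
  (\int[mu]_(s in `]0%R, t[) ca_rhs K J (a c) (a (~~ c)) i s = l%:E)%E.
Proof.
move=> i1 drift_l.
pose f (N : nat -> nat -> R) d j s := a c i s * (N i j * a d j s).
pose F N d s := (\sum_(1 <= j <oo) (f N d j s)%:E)%E.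
pose G s := gain K (fun j => a c j s) i.
have cf N d j : continuous (f N d j) by exact: weighted_rate_cont.
have cG : continuous G.
  apply: continuousZ_fun; apply: (@continuous_sum_nat _ (fun j s => _)) => j s.
  by apply: cvgM; [exact: continuousZ_fun|exact: a_cont].
have f0 N d : (forall i j, (1 <= i)%N -> (1 <= j)%N -> 0 <= N i j) ->
    forall j s, (1 <= j)%N -> s \in `]0, t[ -> 0 <= f N d j s.
  by move=> N0 j s j1 st; rewrite /f !mulr_ge0 ?a_ge0 ?N0.
have M0 s : s \in `]0, t[ -> 0 <= M.
  by move=> st; apply: le_trans (a_ge0 c i st) _; exact: a_le.
have iF N d : (forall i j, (1 <= i)%N -> (1 <= j)%N -> N i j <= L * (rho i * rho j)) ->
    (forall i j, (1 <= i)%N -> (1 <= j)%N -> 0 <= N i j) -> mu.-integrable `]0, t[ (F N d).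
  (* The sign of [M] is known only if []0, t[] has a point, hence the absolute value. *)
  move=> NL N0; apply: (@integrable_series _ _ _ _ _ (`|M| * (L * rho i) * C)) => //.
    exact: f0.
  move=> m; apply: weighted_rate_integral_le => // s st.
  by rewrite a_ge0 // ger0_norm ?(M0 s) // a_le.
have iK := iF K c K_le K_ge0; have iJ := iF J (~~ c) J_le J_ge0.
have iG := continuous_integrable_oo 0 t cG.
(* Terms are nonnegative, so the density may be moved into the series at every time, even where the
   rate sum is infinite. *)
have FE N d s : (forall i j, (1 <= i)%N -> (1 <= j)%N -> 0 <= N i j) -> s \in `]0, t[ ->
    F N d s = ((a c i s)%:E * rate_sum N (a d) i s)%E.
  move=> N0 st; rewrite /F /rate_sum !(eseries_cond _ _ 1) -nneseriesZl //.
  by move=> j /= j1; rewrite lee_fin mulr_ge0 ?N0 ?a_ge0.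
have -> : (\int[mu]_(s in `]0%R, t[) ca_rhs K J (a c) (a (~~ c)) i s)%E =
    (\int[mu]_(s in `]0%R, t[) ((EFin \o G) s - F K c s - F J (~~ c) s))%E.
  apply: eq_integral => s /set_mem st; rewrite /ca_rhs !FE //.
rewrite integralB //; last exact: integrableB.
rewrite integralB //.
have fin N d := @integrable_fin_num _ _ _ mu `]0, t[%classic _ (F N d).
(* All three integrals are finite, which turns the goal into an identity between real limits. *)
rewrite -[X in (_ - X - _)%E](fineK (fin _ _ _ iK)) //.
rewrite -[X in (_ - _ - X)%E](fineK (fin _ _ _ iJ)) //.
rewrite -[X in (X - _ - _)%E](fineK (integrable_fin_num _ iG)) // -!EFinB; congr (_%:E).
have cK := series_Rintegral_cvg (cf K c) (f0 K c K_ge0) iK.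
have cJ := series_Rintegral_cvg (cf J (~~ c)) (f0 J (~~ c) J_ge0) iJ.
apply: (cvg_unique _ _ drift_l) => //.
have -> : (fun m => \int[mu]_(r in `]0, t[)
     drift K J m (fun j => a c j r) (fun j => a (~~ c) j r) i) =
  (fun m => \int[mu]_(s in `]0, t[) G s - \int[mu]_(s in `]0, t[) \sum_(1 <= j < m) f K c j s
     - \int[mu]_(s in `]0, t[) \sum_(1 <= j < m) f J (~~ c) j s).
  apply/funext => m.
  have i1' := continuous_integrable_oo 0 t (continuous_sum_nat (cf K c) (m := m)).
  have i2' := continuous_integrable_oo 0 t (continuous_sum_nat (cf J (~~ c)) (m := m)).
  rewrite -RintegralB // -RintegralB //; last exact: integrableB iG i1'.
  by apply: eq_Rintegral => s _; rewrite /drift /trunc_rate !mulr_sumr.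
by apply: cvgB => //; apply: cvgB => //; exact: cvg_cst.
Qed.

End LimitIsSolution.

(** * Existence for the given rates and data *)

Theorem theorem2p3 (R : realType) (K J : nat -> nat -> R)
  (K_ge0 : forall i j, (1 <= i)%N -> (1 <= j)%N -> 0 <= K i j)
  (K_sym : forall i j, (1 <= i)%N -> (1 <= j)%N -> K i j = K j i)
  (J_ge0 : forall i j, (1 <= i)%N -> (1 <= j)%N -> 0 <= J i j)
  (J_sym : forall i j, (1 <= i)%N -> (1 <= j)%N -> J i j = J j i)
  (rho : nat -> R) (beta : nat -> nat -> R)
  (rho_ge0 : forall i, (1 <= i)%N -> 0 <= rho i)
  (beta_ge0 : forall i j, (1 <= i)%N -> (1 <= j)%N -> 0 <= beta i j)
  (K_split : forall i j, (1 <= i)%N -> (1 <= j)%N ->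
     K i j = rho i * rho j + beta i j)
  (S : R) (rho_inf : inf [set rho i / i%:R | i in [set i | (1 <= i)%N]] = S)
  (S_gt0 : 0 < S)
  (kappa : R) (kappa_gt0 : 0 < kappa)
  (beta_le : forall i j, (1 <= i)%N -> (1 <= j)%N ->
     beta i j <= kappa * (rho i * rho j))
  (J_le : forall i j, (1 <= i)%N -> (1 <= j)%N -> J i j <= rho i * rho j)
  (a0 b0 : nat -> R) (a0_pos : Xpos 0 a0) (b0_pos : Xpos 0 b0) :
  exists a b : nat -> R -> R,
    ca_solution K J a0 b0 +oo%E a b /\
    forall t : R, 0 < t ->
      [/\ Xpos 0 (a ^~ t), Xpos 0 (b ^~ t),
          (Xnorm 1 (a ^~ t) < +oo)%E & (Xnorm 1 (b ^~ t) < +oo)%E].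
Proof.
(* To be a lower bound, [inf] needs a set that is bounded below; 0 bounds these ratios. *)
have S_le i : (1 <= i)%N -> S * i%:R <= rho i.
  move=> i1; rewrite -ler_pdivlMr ?ltr0n // -rho_inf; apply: ge_inf; last by exists i.
  by exists 0 => _ [j /= j1 <-]; rewrite divr_ge0 ?rho_ge0.
(* This constant dominates both rates: [K] by its splitting and [J] because [1 <= L]. *)
pose L := 1 + kappa; have L_ge0 : 0 <= L by rewrite /L; lra.
have rr0 i j : (1 <= i)%N -> (1 <= j)%N -> 0 <= rho i * rho j.
  by move=> i1 j1; rewrite mulr_ge0 ?rho_ge0.
have rho_le i j : (1 <= i)%N -> (1 <= j)%N -> rho i * rho j <= K i j.
  by move=> i1 j1; rewrite K_split // lerDl beta_ge0.
have K_le i j : (1 <= i)%N -> (1 <= j)%N -> K i j <= L * (rho i * rho j).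
  by move=> i1 j1; rewrite K_split // mulrDl mul1r lerD2l beta_le.
have J_le' i j : (1 <= i)%N -> (1 <= j)%N -> J i j <= L * (rho i * rho j).
  move=> i1 j1; apply: le_trans (J_le i j i1 j1) _.
  by rewrite ler_peMl ?rr0 // /L; lra.
pose u c := if c then a0 else b0.
have u_pos c : Xpos 0 (u c) by case: c.
have u_ge0 c i : (1 <= i)%N -> 0 <= u c i by have [_] := u_pos c; apply.
have [Ma aM] := Xpos0_sum_le (u_pos true); have [Mb bM] := Xpos0_sum_le (u_pos false).
pose M := Num.max Ma Mb.
have u_le c n : \sum_(1 <= i < n) u c i <= M.
  by rewrite le_max; case: c; rewrite ?aM ?bM ?orbT.
have [a [[a_cont a_ge0] a_sum a_mom a_int a_drift]] :=
  limit_solution K_ge0 K_sym J_ge0 rho_ge0 rho_le L_ge0 K_le J_le' S_gt0 S_le u_ge0 u_le.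
have a_le c i t : (1 <= i)%N -> 0 <= t -> a c i t <= M.
  move=> i1 t0; apply: le_trans (a_sum c i.+1 t t0); rewrite big_nat_recr //= lerDr.
  by rewrite sumr_ge0 // => j _; exact: a_ge0.
have oo_ge0 t s : s \in `]0, t[ -> 0 <= s by rewrite in_itv => /andP[/ltW].
have a_bound t : 0 <= t -> exists C, forall c m,
    \int[lebesgue_measure]_(r in `]0, t[) (\sum_(1 <= j < m) rho j * a c j r) <= C.
  move=> t0; have [C1 aC] := a_int true t t0; have [C2 bC] := a_int false t t0.
  by exists (Num.max C1 C2) => c m; rewrite le_max; case: c; rewrite ?aC ?bC ?orbT.
have a_ge0' t c i s : s \in `]0, t[ -> 0 <= a c i s.
  by move=> /oo_ge0; exact: a_ge0.
have a_le' t c i s : (1 <= i)%N -> s \in `]0, t[ -> a c i s <= M.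
  by move=> i1 /oo_ge0; exact: a_le.
have rate_int (N : nat -> nat -> R) c i t : (1 <= i)%N -> 0 <= t ->
    (forall i j, (1 <= i)%N -> (1 <= j)%N -> N i j <= L * (rho i * rho j)) ->
    (forall i j, (1 <= i)%N -> (1 <= j)%N -> 0 <= N i j) ->
    lebesgue_measure.-integrable `]0, t[ (rate_sum N (a c) i).
  move=> i1 t0 NL N0; have [C aC] := a_bound t t0.
  exact: (rate_sum_integrable rho_ge0 L_ge0 a_cont (a_ge0' t) aC c i1 NL N0).
have a_eq c i t : (1 <= i)%N -> 0 < t -> (a c i t)%:E = ((u c i)%:E
    + \int[lebesgue_measure]_(s in `]0%R, t[) ca_rhs K J (a c) (a (~~ c)) i s)%E.
  move=> i1 t0; have [C aC] := a_bound t (ltW t0).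
  have -> := ca_rhs_integral K_ge0 J_ge0 rho_ge0 L_ge0 K_le J_le' a_cont
    (a_ge0' t) (a_le' t) aC i1 (a_drift c i t i1 (ltW t0)).
  by rewrite -EFinD addrC subrK.
exists (a true), (a false); split.
  split=> //.
  - by move=> i t i1 [t0 _]; split; exact: a_ge0.
  - by move=> i i1; split; exact: continuous_subspaceT.
  - by move=> i t i1 [t0 _]; split; exact: rate_int.
  - by move=> i t i1 t0 _; split; [exact: (a_eq true)|exact: (a_eq false)].
move=> t t0; have t0' := ltW t0.
have X0 c : Xpos 0 (a c ^~ t).
  split=> [|i i1]; last exact: a_ge0.
  apply: (@Xnorm_lt_pinfty _ _ _ M) => m; apply: le_trans (a_sum c m t t0').
  by apply: ler_sum => i _; rewrite powRr0 mul1r ger0_norm // a_ge0.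
have X1 c : (Xnorm 1 (a c ^~ t) < +oo)%E.
  have [C aC] := a_mom c t t0.
  apply: (@Xnorm_lt_pinfty _ _ _ C) => m; apply: le_trans (aC m).
  by apply: ler_sum => i _; rewrite powRr1 // ger0_norm // a_ge0.
by split.
Qed.
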